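(* Let $S(n)$ be the maximum size of a Sidon subset $A\subseteq\{1,\dots,n\}$ such that there are no pairwise distinct $x_1,\dots,x_5\in A$ with $x_1+x_2+x_3+x_4=4x_5$. Then $S(n)=o(\sqrt n)$ and $S(n)\ge n^{1/2-o(1)}$; that is, $S(n)/\sqrt n\to 0$, and for every $\varepsilon>0$ we have $S(n)\ge n^{1/2-\varepsilon}$ for all sufficiently large $n$.
   Context: A set $A$ of integers is a Sidon set if it has no nontrivial solution to $x_1+x_2=x_3+x_4$ with $x_i\in A$, where a solution is trivial if $\{x_1,x_2\}=\{x_3,x_4\}$ (i.e. $(x_1,x_2)=(x_3,x_4)$ or $(x_4,x_3)$). *)

(* Defs.v *)
From mathcomp Require Import all_boot.
From Stdlib Require Import Reals.
Set Implicit Arguments. Unset Strict Implicit. Unset Printing Implicit Defensive.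

(* Subsets of {1,...,n} are sets A : {set 'I_n.+1} with 0 \notin A;
   elements are compared through their nat values. *)

Definition sidonb (n : nat) (A : {set 'I_n.+1}) : bool :=
  [forall x1 in A, forall x2 in A, forall x3 in A, forall x4 in A,
     (nat_of_ord x1 + x2 == x3 + x4)%N ==>
       ((x1 == x3) && (x2 == x4)) || ((x1 == x4) && (x2 == x3))].

Definition no_4x5b (n : nat) (A : {set 'I_n.+1}) : bool :=
  ~~ [exists x1 in A, exists x2 in A, exists x3 in A, exists x4 in A,
       exists x5 in A,
       uniq [:: x1; x2; x3; x4; x5] &&
       (nat_of_ord x1 + x2 + x3 + x4 == 4 * x5)%N].

Definition good (n : nat) (A : {set 'I_n.+1}) : bool :=
  [&& (ord0 \notin A), sidonb A & no_4x5b A].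

(* S(n): maximum size of such a set (the empty set always qualifies). *)
Definition Smax (n : nat) : nat := (\max_(A : {set 'I_n.+1} | good A) #|A|)%N.

(* Main.v *)
(** Upper bound.  Let [A] be a Sidon set in an abelian group of odd order [N], with
    [|A|^2 >= delta N].  Its nonzero differences form a dense set [S], and
    [|1_A * f|^2 = |A| |f|^2 + <f, 1_S * f>] in [l^2], so [A] behaves like a dense set in
    second-moment estimates.  Random sampling from [S] (Croot-Sisask) yields dense sets of
    almost-periods for [1_A * 1_A * 1_A] and for [1_A * 1_T].  Smooth [1_A] by the uniform
    measure on [T - T]: the [l^2] energy of the smoothed function is bounded, so along a
    chain of ever finer sets [T] two consecutive smoothings [F], [F'] are [l^2]-close.  The
    finer one counts the solutions of [x1 + x2 + x3 + x4 = 4 x5] in [A] correctly, the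
    coarser one is almost invariant under an intermediate set [V] of shifts, and on the
    dense set where [F] is large one finds solutions [y, y + t1, ..., y + t4] with
    [t1 + ... + t4 = 0] and [ti] in [V - V].  Hence [A] contains [>> |A|^3] solutions,
    whereas only [O(|A|^2)] of them have a repeated variable.

    Lower bound.  Take the parabola [(u, u^2)] over the field with [p^k] elements, write
    both coordinates in the [k] digits of an ['F_p]-basis, and read these as digits in base
    [4 p], so that no carries occur.  This is a Sidon set; restricting the digit vector of
    [u] to a sphere (Behrend) excludes nontrivial solutions of [x1 + x2 + x3 + x4 = 4 x5]
    by strict convexity. *)
Require Import Defs.
From Stdlib Require Import Reals Lra FunctionalExtensionality.
From mathcomp Require Import all_boot all_order all_algebra all_field.
From mathcomp Require Import zify.
From mathcomp Require ring lra.
From mathcomp Require Import Rstruct.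
Set Implicit Arguments. Unset Strict Implicit. Unset Printing Implicit Defensive.
Import Order.TTheory GRing.Theory Num.Theory.

(** * Convolution and the second moment of a Sidon set in a finite abelian group *)

Section Convolution.
Import ring lra.
Variables (R : realFieldType) (G : finZmodType).
Local Open Scope ring_scope.
Implicit Types (f g h : G -> R) (A S T : {set G}).

Definition ind T : G -> R := fun x => (x \in T)%:R.
Definition sh (t : G) f : G -> R := fun x => f (x - t).
Definition conv A f : G -> R := fun x => \sum_(a in A) f (x - a).
Definition sqn f : R := \sum_x f x ^+ 2.

(** Difference form of the Sidon condition, equivalent to the sum form in any abelian group, even in
    the presence of 2-torsion. *)
Definition sidon A : Prop :=
  forall a b c d, a \in A -> b \in A -> c \in A -> d \in A ->
  a - b = c - d -> a != b -> a = c /\ b = d.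

Definition diffs A : {set G} :=
  [set p.1 - p.2 | p in [set q | [&& q.1 \in A, q.2 \in A & q.1 != q.2]]].

Lemma sum_shift (t : G) f : \sum_x f (x + t) = \sum_x f x.
Proof. by rewrite [RHS](reindex_inj (addIr t)). Qed.

Lemma sum_shiftB (t : G) f : \sum_x f (x - t) = \sum_x f x.
Proof. exact: (sum_shift (- t)). Qed.

Lemma sum_reflect (t : G) f : \sum_x f (t - x) = \sum_x f x.
Proof. by rewrite [RHS](reindex_inj (inj_comp (addrI t) oppr_inj)). Qed.

Lemma sqn_ge0 f : 0 <= sqn f.
Proof. by apply: sumr_ge0 => x _; exact: sqr_ge0. Qed.

Lemma eq_sqn f g : f =1 g -> sqn f = sqn g.
Proof. by move=> e; apply: eq_bigr => x _; rewrite e. Qed.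

Lemma sqn_sh (t : G) f : sqn (sh t f) = sqn f.
Proof. exact: (sum_shiftB t (fun x => f x ^+ 2)). Qed.

Lemma sqn_scale (c : R) f : sqn (fun x => c * f x) = c ^+ 2 * sqn f.
Proof. by rewrite mulr_sumr; apply: eq_bigr => x _; rewrite exprMn. Qed.

Lemma sqn_add_le f g : sqn (fun x => f x + g x) <= 2 * sqn f + 2 * sqn g.
Proof.
rewrite !mulr_sumr -big_split /=; apply: ler_sum => x _.
have := sqr_ge0 (f x - g x); nra.
Qed.

Lemma sqn_triangle f g h :
  sqn (fun x => f x - h x) <=
  2 * sqn (fun x => f x - g x) + 2 * sqn (fun x => g x - h x).
Proof.
apply: le_trans (sqn_add_le _ _); rewrite le_eqVlt; apply/orP; left; apply/eqP.
by apply: eq_sqn => x; ring.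
Qed.

(** The gap is a positive multiple of the sum of the squares of [k f - g]. The weight [k], chosen at
    each use to balance the two norms, replaces the square roots of Cauchy-Schwarz. *)
Lemma inner_le_amgm (k : R) f g : 0 < k ->
  \sum_x f x * g x <= (k * sqn f + k^-1 * sqn g) / 2.
Proof.
move=> k0; rewrite !mulr_sumr -big_split mulr_suml /=; apply: ler_sum => x _.
have e : (k * f x ^+ 2 + k^-1 * g x ^+ 2) / 2 - f x * g x
          = k^-1 / 2 * (k * f x - g x) ^+ 2 by field; rewrite gt_eqF.
rewrite -subr_ge0 e mulr_ge0 ?sqr_ge0 //.
by rewrite divr_ge0 // invr_ge0 ltW.
Qed.

(** Cauchy-Schwarz against the constant 1, from non-negativity of the unnormalised variance of [F]
    on [P]. *)
Lemma sum_sqr_le (I : finType) (P : pred I) (F : I -> R) :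
  (\sum_(i | P i) F i) ^+ 2 <= #|P|%:R * \sum_(i | P i) F i ^+ 2.
Proof.
set s := \sum_(i | P i) F i; set q := \sum_(i | P i) F i ^+ 2.
have: 0 <= \sum_(i | P i) (#|P|%:R * F i - s) ^+ 2.
  by apply: sumr_ge0 => i _; exact: sqr_ge0.
have -> : \sum_(i | P i) (#|P|%:R * F i - s) ^+ 2 =
  #|P|%:R * (#|P|%:R * q - s ^+ 2).
  have e i : (#|P|%:R * F i - s) ^+ 2 =
    #|P|%:R ^+ 2 * F i ^+ 2 - (2 * #|P|%:R * s) * F i + s ^+ 2 by ring.
  under eq_bigr => i _ do rewrite e.
  rewrite big_split /= sumrB -!mulr_sumr -/s -/q sumr_const -mulr_natl.
  by ring.
case: (posnP #|P|) => [P0 _|P0].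
  by rewrite /s big_pred0 ?expr0n ?P0 ?mul0r // => i; exact: (card0_eq P0 i).
by rewrite pmulr_rge0 ?ltr0n // subr_ge0.
Qed.

Lemma conv_sh A t f x : conv A (sh t f) x = sh t (conv A f) x.
Proof. by apply: eq_bigr => a _; rewrite /sh addrAC. Qed.

Lemma convB A f g x : conv A (fun x => f x - g x) x = conv A f x - conv A g x.
Proof. by rewrite /conv sumrB. Qed.

Lemma sum_ind T : \sum_x ind T x = #|T|%:R.
Proof.
rewrite -sum1_card natr_sum [RHS]big_mkcond; apply: eq_bigr => x _.
by rewrite /ind; case: ifP.
Qed.

Lemma sqn_ind T : sqn (ind T) = #|T|%:R.
Proof.
rewrite -sum_ind; apply: eq_bigr => x _; rewrite /ind.
by case: (x \in T); rewrite ?expr1n ?expr0n.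
Qed.

Lemma sum_in_ind T (F : G -> R) : \sum_(x in T) F x = \sum_x ind T x * F x.
Proof.
rewrite big_mkcond; apply: eq_bigr => x _; rewrite /ind.
by case: ifP; rewrite ?mul1r ?mul0r.
Qed.

Lemma card_diffs A : sidon A -> #|diffs A| = (#|A| * #|A|.-1)%N.
Proof.
move=> sA; rewrite card_in_imset => [|[a b] [c d]]; last first.
  rewrite !inE /= => /and3P[aA bA ab] /and3P[cA dA cd] e.
  by have [-> ->] := sA _ _ _ _ aA bA cA dA e ab.
rewrite -sum1_card -sum_nat_const; under eq_bigl => p do rewrite inE.
rewrite -(pair_big_dep (mem A) (fun a b => (b \in A) && (a != b)) (fun a b => 1%N)) /=.
apply: eq_bigr => a aA; rewrite (cardsD1 a A) aA /= -sum1_card.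
by apply: eq_bigl => b; rewrite !inE andbC eq_sym.
Qed.

(* Expanding the square leaves one autocorrelation of [f] per pair of elements of [A], and
   by the Sidon property each nonzero difference occurs for exactly one pair. *)
Lemma sqn_conv A f : sidon A ->
  sqn (conv A f) = #|A|%:R * sqn f + \sum_x f x * conv (diffs A) f x.
Proof.
move=> sA; pose c d := \sum_x f x * f (x - d).
have -> : sqn (conv A f) = \sum_(a in A) \sum_(b in A) c (b - a).
  rewrite /sqn /conv; under eq_bigr => x _ do rewrite expr2 big_distrlr.
  rewrite exchange_big; apply: eq_bigr => a _; rewrite exchange_big; apply: eq_bigr => b _.
  by rewrite -(sum_shift a); apply: eq_bigr => x _; rewrite addrK opprB addrA addrAC.
have -> : \sum_x f x * conv (diffs A) f x = \sum_(s in diffs A) c s.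
  by rewrite exchange_big /=; apply: eq_bigr => x _; rewrite mulr_sumr.
rewrite big_imset /= => [|[a b] [c' d]]; last first.
  rewrite !inE /= => /and3P[aA bA ab] /and3P[cA dA cd] e.
  by have [-> ->] := sA _ _ _ _ aA bA cA dA e ab.
rewrite exchange_big.
have -> : #|A|%:R * sqn f = \sum_(b in A) c 0.
  rewrite sumr_const -[RHS]mulr_natl; congr (_ * _).
  by apply: eq_bigr => x _; rewrite subr0 expr2.
under [X in _ = _ + X]eq_bigl => p do rewrite inE.
rewrite -(pair_big_dep (mem A) (fun a b => (b \in A) && (a != b)) (fun a b => c (a - b))) /=.
rewrite -big_split /=; apply: eq_bigr => b bA.
rewrite (bigD1 b bA) /= subrr; congr (_ + _); apply: eq_bigl => a.
by rewrite eq_sym.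
Qed.

End Convolution.

(** * Random sampling and almost-periods *)

Section Sampling.
Import ring lra.
Variables (R : realFieldType) (G : finZmodType).
Local Open Scope ring_scope.
Implicit Types (f g h : G -> R) (A S T : {set G}) (phi psi : seq G -> R).

(** An unnormalised expectation over [m] independent uniform samples from [S]. *)
Fixpoint tsum S m phi : R :=
  if m is m'.+1 then \sum_(s in S) tsum S m' (fun y => phi (s :: y)) else phi [::].

Lemma ler_tsum S m phi psi : (forall y, phi y <= psi y) ->
  tsum S m phi <= tsum S m psi.
Proof.
elim: m phi psi => [|m IH] phi psi le //=.
by apply: ler_sum => s _; apply: IH.
Qed.

Lemma tsum_sum (I : finType) (P : pred I) S m (F : I -> seq G -> R) :
  tsum S m (fun y => \sum_(i | P i) F i y) = \sum_(i | P i) tsum S m (F i).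
Proof.
elim: m F => [|m IH] F //=.
by rewrite exchange_big; apply: eq_bigr => s _; apply: IH.
Qed.

Lemma tsumZ S m c phi : tsum S m (fun y => c * phi y) = c * tsum S m phi.
Proof.
elim: m phi => [|m IH] phi //=.
by rewrite mulr_sumr; apply: eq_bigr => s _; apply: IH.
Qed.

Lemma tsum_const S m c : tsum S m (fun=> c) = #|S|%:R ^+ m * c.
Proof.
elim: m => [|m IH] /=; first by rewrite mul1r.
by under eq_bigr do rewrite IH; rewrite sumr_const -[LHS]mulr_natl mulrA exprS.
Qed.

Lemma tsum_sub S T m phi : S \subset T -> (forall y, 0 <= phi y) ->
  tsum S m phi <= tsum T m phi.
Proof.
move=> /subsetP ST; elim: m phi => [|m IH] phi ge0 //=.
have pos U n psi : (forall y, 0 <= psi y) -> 0 <= tsum U n psi.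
  move=> h; rewrite (le_trans _ (ler_tsum U n h)) // tsum_const mulr0 //.
rewrite [leRHS](bigID (mem S)) /=.
rewrite [X in _ <= X + _](eq_bigl (fun s => s \in S)) => [|s]; last first.
  by apply: andb_idl => /ST.
rewrite -[leLHS]addr0 lerD ?sumr_ge0 // => [|s _]; last by apply: pos.
by apply: ler_sum => s _; apply: IH.
Qed.

Lemma tsum_shift m t phi :
  tsum [set: G] m (fun y => phi [seq s - t | s <- y]) = tsum [set: G] m phi.
Proof.
elim: m phi => [|m IH] phi //=.
under eq_bigr => s _ do rewrite (IH (fun y => phi (s - t :: y))).
under eq_bigl do rewrite inE; under [RHS]eq_bigl do rewrite inE.
exact: (sum_shiftB t (fun s => tsum setT m (fun y => phi (s :: y)))).
Qed.

Lemma sum_le_max (S : {set G}) (F : G -> R) (s0 : G) : s0 \in S ->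
  exists2 s, s \in S & \sum_(i in S) F i <= #|S|%:R * F s.
Proof.
move=> s0S; case: (@Order.TotalTheory.arg_maxP _ R _ s0 (mem S) F s0S) => s sS mx.
exists s => //; rewrite mulr_natl -sumr_const; apply: ler_sum => i iS.
exact: mx.
Qed.

Lemma tsum_le_max m phi :
  exists2 y, size y = m & tsum [set: G] m phi <= #|G|%:R ^+ m * phi y.
Proof.
elim: m phi => [|m IH] phi /=; first by exists [::]; rewrite // mul1r.
have [s _ le] := sum_le_max (fun s => tsum setT m (fun y => phi (s :: y))) (in_setT (0 : G)).
have [y sy ley] := IH (fun y => phi (s :: y)).
exists (s :: y); rewrite /= ?sy //; apply: (le_trans le).
by rewrite cardsT exprS -mulrA ler_wpM2l // ler0n.
Qed.

(** The samples are independent and [Z] has mean zero on [S], so variances add. The constant [c]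
    serves the induction, which absorbs the first sample into it. *)
Lemma tsum_second_moment S m c (Z : G -> R) : \sum_(s in S) Z s = 0 ->
  #|S|%:R * tsum S m (fun y => (c + \sum_(s <- y) Z s) ^+ 2)
  = #|S|%:R ^+ m * (#|S|%:R * c ^+ 2 + m%:R * \sum_(s in S) Z s ^+ 2).
Proof.
move=> Z0; elim: m c => [|m IH] c /=.
  by rewrite big_nil addr0 mul1r mul0r addr0.
rewrite [LHS]mulr_sumr.
have e s : #|S|%:R * tsum S m (fun y => (c + \sum_(i <- s :: y) Z i) ^+ 2)
  = #|S|%:R ^+ m * (#|S|%:R * c ^+ 2 + m%:R * \sum_(s in S) Z s ^+ 2)
    + #|S|%:R ^+ m.+1 * (2 * c) * Z s + #|S|%:R ^+ m.+1 * Z s ^+ 2.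
  have -> : tsum S m (fun y => (c + \sum_(i <- s :: y) Z i) ^+ 2) =
    tsum S m (fun y => (c + Z s + \sum_(i <- y) Z i) ^+ 2).
    by apply: le_anti; rewrite !ler_tsum // => y; rewrite big_cons addrA.
  by rewrite IH [_ ^+ m.+1]exprS; ring.
rewrite (eq_bigr _ (fun s _ => e s)).
rewrite 2!big_split /= -!mulr_sumr Z0 sumr_const -[_ *+ #|S|]mulr_natl.
by rewrite -[in RHS]natr1 ![_ ^+ m.+1]exprS; ring.
Qed.

(* Croot-Sisask: for at least half of the samples [y] of [m] points of [S], the average of
   the translates of [h] by [y] is [l^2]-close to the normalised [conv S h].  Some [y] has
   many translates [y - t] in that half, and then each [sh t (conv S h)] is close to the
   same function. *)
Lemma almost_periods S h (K : R) m T : (0 < m)%N -> (0 < #|S|)%N ->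
  0 < K -> sqn h <= K ->
  exists T' : {set G}, [/\ T' \subset T,
    #|T|%:R * #|S|%:R ^+ m <= 2 * #|G|%:R ^+ m * #|T'|%:R :> R &
    forall t t', t \in T' -> t' \in T' ->
      m%:R * sqn (fun x => conv S (sh t h) x - conv S (sh t' h) x)
      <= 8 * K * #|S|%:R ^+ 2].
Proof.
move=> m0 S0 K0 hK.
have s0 : 0 < #|S|%:R :> R by rewrite ltr0n.
have M0 : 0 < m%:R :> R by rewrite ltr0n.
pose av x := conv S h x / #|S|%:R.
(* [W y] is [m] times the error of the sample mean; its expected squared norm is at most [m K]. *)
pose W y x := \sum_(s <- y) (h (x - s) - av x).
pose E y := sqn (W y).
have tE : tsum S m E <= #|S|%:R ^+ m * (m%:R * K).
  rewrite -(ler_pM2l s0) /E /sqn tsum_sum mulr_sumr.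
  have le x : #|S|%:R * tsum S m (fun y => W y x ^+ 2) <=
    #|S|%:R ^+ m * m%:R * \sum_(s in S) h (x - s) ^+ 2.
    pose Z s := h (x - s) - av x.
    have Z0 : \sum_(s in S) Z s = 0.
      rewrite sumrB sumr_const -[av x *+ _]mulr_natl mulrC divfK ?gt_eqF //.
      by rewrite subrr.
    have := tsum_second_moment m 0 Z0; rewrite expr0n mulr0 add0r.
    have -> : tsum S m (fun y => (0 + \sum_(s <- y) Z s) ^+ 2) =
       tsum S m (fun y => W y x ^+ 2).
      by apply: le_anti; rewrite !ler_tsum // => y; rewrite add0r.
    move=> ->; rewrite -[leRHS]mulrA;
    do 2 (apply: ler_wpM2l; first by rewrite ?exprn_ge0 // ltW).
    rewrite -subr_ge0 -sumrB.
    have -> : \sum_(s in S) (h (x - s) ^+ 2 - Z s ^+ 2) =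
       \sum_(s in S) av x ^+ 2 + (2 * av x) * \sum_(s in S) Z s.
      by rewrite mulr_sumr -big_split /=; apply: eq_bigr => s _; rewrite /Z; ring.
    rewrite Z0 mulr0 addr0.
    by apply: sumr_ge0 => s _; exact: sqr_ge0.
  apply: (le_trans (ler_sum _ (fun x _ => le x))).
  rewrite -mulr_sumr exchange_big /=.
  under eq_bigr => s _ do rewrite (sum_shiftB s (fun x => h x ^+ 2)).
  rewrite sumr_const -[_ *+ #|S|]mulr_natl.
  rewrite [X in _ <= X](_ : _ = #|S|%:R ^+ m * m%:R * (#|S|%:R * K)); last by ring.
  by rewrite !ler_wpM2l ?mulr_ge0 ?exprn_ge0 ?ler0n.
(* Markov at twice the mean: at least half of the samples are good. *)
pose good y := E y <= 2 * m%:R * K.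
have tgood : #|S|%:R ^+ m <= 2 * tsum S m (fun y => (good y)%:R).
  have le y : 1 <= (good y)%:R + (2 * m%:R * K)^-1 * E y.
    have q0 : 0 < 2 * m%:R * K by rewrite !mulr_gt0.
    rewrite /good; case: (leP (E y) (2 * m%:R * K)) => [_|/ltW b].
      by rewrite lerDl mulr_ge0 ?sqn_ge0 // invr_ge0 ltW.
    by rewrite add0r mulrC ler_pdivlMr // mul1r.
  have := ler_tsum S m le; rewrite tsum_const mulr1.
  have -> : tsum S m (fun y => (good y)%:R + (2 * m%:R * K)^-1 * E y) =
    tsum S m (fun y => (good y)%:R) + (2 * m%:R * K)^-1 * tsum S m E.
    rewrite -tsumZ; have := tsum_sum predT S m
      (fun (b : bool) y => if b then (good y)%:R else (2 * m%:R * K)^-1 * E y).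
    rewrite big_bool /= => <-.
    by apply: le_anti; rewrite !ler_tsum // => y; rewrite big_bool.
  move=> l1.
  have : (2 * m%:R * K)^-1 * tsum S m E <= #|S|%:R ^+ m / 2.
    apply: (@le_trans _ _ ((2 * m%:R * K)^-1 * (#|S|%:R ^+ m * (m%:R * K)))).
      by rewrite ler_wpM2l // invr_ge0 !mulr_ge0 ?ltW.
    rewrite le_eqVlt; apply/orP; left; apply/eqP; field.
    by rewrite !gt_eqF.
  lra.
(* Translation preserves the counting measure on [m]-tuples from [G] but not on those from [S].
   Passing from [S] to [G] costs the factor [(|S| / |G|)^m] in the size of [T']. *)
have tot : #|T|%:R * #|S|%:R ^+ m <= 2 *
  tsum setT m (fun y => \sum_(t in T) (good [seq s - t | s <- y])%:R).
  rewrite tsum_sum; under [X in _ <= 2 * X]eq_bigr => t _ do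
    rewrite (tsum_shift m t (fun y => (good y)%:R)).
  rewrite sumr_const mulr_natl mulrnAr ler_wMn2r //; move: tgood.
  by have := tsum_sub m (subsetT S) (fun y => ler0n R (good y)); lra.
have [y sy ley] := tsum_le_max m
  (fun y => \sum_(t in T) (good [seq s - t | s <- y])%:R).
exists [set t in T | good [seq s - t | s <- y]]; split.
- by apply/subsetP => t; rewrite inE => /andP[].
- apply: (le_trans tot); rewrite -mulrA ler_wpM2l //; apply: (le_trans ley).
  rewrite ler_wpM2l ?exprn_ge0 // -sum1_card natr_sum [leRHS]big_mkcond [leLHS]big_mkcond.
  by apply: ler_sum => t _; rewrite inE; case: (t \in T) => //=; case: ifP.
move=> t t'; rewrite !inE => /andP[_ gt] /andP[_ gt'].
(* The sum over the sample does not depend on [u], so it cancels between [t] and [t'] and only the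
   two translates of [av] remain. *)
have Wt u x : W [seq s - u | s <- y] (x - u) =
   \sum_(s <- y) h (x - s) - m%:R * av (x - u).
  rewrite /W big_map sumrB; congr (_ - _); last first.
    by rewrite big_const_seq count_predT sy iter_addr_0 mulr_natl.
  by apply: eq_bigr => s _; rewrite opprB addrA subrK.
have key : sqn (fun x => m%:R / #|S|%:R * (conv S (sh t h) x - conv S (sh t' h) x))
   <= 8 * m%:R * K.
  have -> : sqn (fun x => m%:R / #|S|%:R * (conv S (sh t h) x - conv S (sh t' h) x))
   = sqn (fun x => sh t' (W [seq s - t' | s <- y]) x + - sh t (W [seq s - t | s <- y]) x).
    apply: eq_sqn => x; rewrite !conv_sh /sh !Wt /av; field; by rewrite gt_eqF.
  apply: le_trans (sqn_add_le _ _) _.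
  have -> : sqn (fun x => - sh t (W [seq s - t | s <- y]) x) =
     sqn (sh t (W [seq s - t | s <- y])).
    by apply: eq_bigr => x _; rewrite sqrrN.
  rewrite !sqn_sh; move: gt gt'; rewrite /good /E; lra.
rewrite sqn_scale in key.
set Q := sqn _ in key *.
have -> : m%:R * Q = ((m%:R / #|S|%:R) ^+ 2 * Q) * (#|S|%:R ^+ 2 / m%:R).
  by field; rewrite !gt_eqF.
apply: (@le_trans _ _ (8 * m%:R * K * (#|S|%:R ^+ 2 / m%:R))).
  by rewrite ler_wpM2r // divr_ge0 ?sqr_ge0 ?ler0n.
rewrite le_eqVlt; apply/orP; left; apply/eqP; field; by rewrite !gt_eqF.
Qed.

End Sampling.

(** * Almost-periods of a dense Sidon set *)

Section Periods.
Import ring lra.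
Variable R : archiRealFieldType.
Local Open Scope ring_scope.

Lemma natr_bound (x : R) : exists n : nat, forall m : nat, (n <= m)%N -> x <= m%:R.
Proof.
exists (Num.bound `|x|) => m nm; apply: (le_trans (ler_norm x)).
by rewrite (le_trans (ltW (archi_boundP (normr_ge0 x)))) // ler_nat.
Qed.

Lemma sqr_card_le_diffs (G : finZmodType) (A : {set G}) : sidon A -> (1 < #|A|)%N ->
  #|A|%:R ^+ 2 <= 2 * #|diffs A|%:R :> R.
Proof.
move=> sA A1; rewrite -natrX -natrM ler_nat (card_diffs sA).
by case: #|A| A1 => [|[|a]] // _; rewrite expnS expn1 /=; nia.
Qed.

Lemma sidon_card_sqr (G : finZmodType) (A : {set G}) : sidon A -> (1 < #|A|)%N ->
  #|A|%:R ^+ 2 <= 2 * #|G|%:R :> R.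
Proof.
move=> sA A1; apply: le_trans (sqr_card_le_diffs sA A1) _.
by rewrite ler_pM2l // ler_nat max_card.
Qed.

(** Apply [sqn_conv] to the difference of two translates of [h]. The diagonal term is [O(|A| N)]
    with [N = |G|], negligible against [N^2] because [|A| = O(sqrt N)]; the other term is controlled
    by almost-periods for [diffs A], which is dense. *)
Lemma sidon_almost_periods (delta eps : R) : 0 < delta -> 0 < eps ->
  exists2 c : R, 0 < c & exists N0 : nat,
  forall (G : finZmodType) (A T : {set G}) (h : G -> R),
  (N0 <= #|G|)%N -> sidon A -> delta * #|G|%:R <= #|A|%:R ^+ 2 ->
  (forall x, 0 <= h x <= 2) ->
  exists T' : {set G}, [/\ T' \subset T, c * #|T|%:R <= #|T'|%:R &
    forall t t', t \in T' -> t' \in T' ->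
    sqn (fun x => conv A (sh t h) x - conv A (sh t' h) x) <= eps * #|G|%:R ^+ 2].
Proof.
move=> d0 e0.
(* With weight [eps N / 8] in [inner_le_amgm] and the sampling bound [32 N^3 / m], taking
   [m >= 512 / eps^2] makes both weighted norms at most [eps N^2 / 2]. *)
have [m /(_ m (leqnn m)) Hm] := natr_bound (512 / eps ^+ 2 + 1).
have ee0 : 0 < eps ^+ 2 by rewrite exprn_gt0.
have m0 : 0 < m%:R :> R.
  by apply: lt_le_trans Hm; rewrite ltr_pwDr // divr_ge0 ?ltW.
have m512 : 512 <= eps ^+ 2 * m%:R.
  rewrite -ler_pdivrMl // mulrC; lra.
exists ((delta / 2) ^+ m / 2); first by rewrite divr_gt0 ?exprn_gt0 ?divr_gt0.
(* The first threshold gives [|A| <= sqrt (2 N) <= eps N / 8]; the second forces [|A| > 1]. *)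
have [n1 H1] := natr_bound (128 / eps ^+ 2).
have [n2 H2] := natr_bound (4 / delta).
exists (maxn n1 (maxn n2 1)) => G A T h; rewrite !geq_max => /and3P[l1 l2 l0] sA dA h02.
have N0 : 0 < #|G|%:R :> R by rewrite ltr0n.
have e128 : 128 <= eps ^+ 2 * #|G|%:R.
  by rewrite -ler_pdivrMl // mulrC H1.
have d4 : 4 <= delta * #|G|%:R by rewrite -ler_pdivrMl // mulrC H2.
have A1 : (1 < #|A|)%N.
  rewrite -(@ltr_nat R) ltNge; apply/negP => le1.
  have : #|A|%:R ^+ 2 <= 1 :> R by rewrite expr_le1 ?ler0n.
  lra.
have aN := sidon_card_sqr sA A1.
have a0 : 0 <= #|A|%:R :> R by exact: ler0n.
set S := diffs A; set N := (#|G|%:R : R) in N0 e128 d4 aN dA *.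
have SN : #|S|%:R <= N :> R by rewrite ler_nat max_card.
have dS : delta / 2 * N <= #|S|%:R.
  by have := sqr_card_le_diffs sA A1; rewrite -/S; lra.
have S0 : (0 < #|S|)%N.
  by rewrite -(@ltr_nat R); apply: lt_le_trans dS; rewrite mulr_gt0 ?divr_gt0.
have hK : sqn h <= 4 * N.
  apply: (@le_trans _ _ (\sum_(x : G) 4)).
    by apply: ler_sum => x _; have := h02 x => /andP[]; nra.
  by rewrite sumr_const mulr_natr.
have m0' : (0 < m)%N by rewrite -(@ltr_nat R).
have K0 : 0 < 4 * N by rewrite mulr_gt0.
have [T' [sub big per]] := almost_periods T m0' S0 K0 hK.
exists T'; split=> //.
  rewrite -(ler_pM2r (_ : 0 < 2 * N ^+ m)); last by rewrite mulr_gt0 ?exprn_gt0.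
  rewrite [leRHS]mulrC; apply: le_trans big.
  have -> : (delta / 2) ^+ m / 2 * #|T|%:R * (2 * N ^+ m) =
    #|T|%:R * (delta / 2 * N) ^+ m.
    by rewrite [(_ * N) ^+ m]exprMn; move: (_ ^+ m) (N ^+ m) => x y; field.
  have dN0 : 0 <= delta / 2 * N by rewrite mulr_ge0 ?divr_ge0 ?ltW.
  by rewrite ler_wpM2l ?ler0n // lerXn2r // nnegrE ?ler0n.
move=> t t' tT tT'.
pose D x := sh t h x - sh t' h x.
have -> : sqn (fun x => conv A (sh t h) x - conv A (sh t' h) x) = sqn (conv A D).
  by apply: eq_sqn => x; rewrite convB.
rewrite sqn_conv // -/S.
have D4 : sqn D <= 4 * N.
  apply: (@le_trans _ _ (\sum_(x : G) 4)).
    apply: ler_sum => x _; rewrite /D /sh.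
    by move: (h02 (x - t)) (h02 (x - t')) => /andP[? ?] /andP[? ?]; nra.
  by rewrite sumr_const mulr_natr.
have SD : m%:R * sqn (conv S D) <= 32 * N ^+ 3.
  have -> : sqn (conv S D) = sqn (fun x => conv S (sh t h) x - conv S (sh t' h) x).
    by apply: eq_sqn => x; rewrite convB.
  apply: le_trans (per _ _ tT tT') _.
  have : #|S|%:R ^+ 2 <= N ^+ 2 by rewrite lerXn2r // nnegrE ?ler0n.
  move=> lS; have := ler_wpM2l (ltW K0) lS; rewrite !exprS expr0; lra.
have k0 : 0 < eps / 8 * N by rewrite mulr_gt0 ?divr_gt0.
have amgm := inner_le_amgm D (conv S D) k0.
have i2 : (eps / 8 * N)^-1 * sqn (conv S D) <= eps / 2 * N ^+ 2.
  rewrite mulrC ler_pdivrMr // -(ler_pM2l m0); apply: le_trans SD _.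
  have := ler_wpM2r (exprn_ge0 3 (ltW N0)) m512; lra.
have i1 : eps / 8 * N * sqn D <= eps / 2 * N ^+ 2.
  have := ler_wpM2l (ltW k0) D4; lra.
have i0 : #|A|%:R * sqn D <= eps / 2 * N ^+ 2.
  apply: (@le_trans _ _ (#|A|%:R * (4 * N))); first by rewrite ler_wpM2l.
  have aeN : #|A|%:R <= eps / 8 * N.
    rewrite -(@ler_pXn2r _ 2) ?nnegrE // ?(ltW k0) //.
    have := ler_wpM2r (ltW N0) e128; nra.
  have := ler_wpM2r (ltW K0) aeN; lra.
lra.
Qed.

End Periods.

(** * Energy of smoothed indicator functions *)

Section Energy.
Import ring lra.
Variables (R : realFieldType) (G : finZmodType).
Local Open Scope ring_scope.
Implicit Types (f g h : G -> R) (A S T U : {set G}).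

Definition favg A T : G -> R := fun x => #|T|%:R^-1 * conv T (ind R A) x.
(* [smooth A T] convolves [ind A] with the law of [t - t'] for uniform [t], [t'] in [T]; the
   symmetry makes its Fourier multiplier nonnegative, which drives [sqn_smooth_diff]. *)
Definition smooth A T : G -> R :=
  fun x => #|T|%:R^-1 * \sum_(v in T) favg A T (x + v).

Lemma conv_indC A T x : conv A (ind R T) x = conv T (ind R A) x.
Proof.
rewrite /conv !sum_in_ind -(sum_reflect x) /=.
by apply: eq_bigr => a _; rewrite subKr mulrC.
Qed.

Lemma favg_ge0 A T x : 0 <= favg A T x.
Proof. by rewrite mulr_ge0 ?invr_ge0 ?ler0n // sumr_ge0 // => a _; rewrite ler0n. Qed.

Lemma smooth_ge0 A T x : 0 <= smooth A T x.
Proof. by rewrite mulr_ge0 ?invr_ge0 ?ler0n // sumr_ge0 // => a _; rewrite favg_ge0. Qed.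

Lemma sum_favg A T : (0 < #|T|)%N -> \sum_x favg A T x = #|A|%:R.
Proof.
move=> T0; rewrite -mulr_sumr exchange_big /=.
under eq_bigr => t _ do rewrite sum_shiftB sum_ind.
by rewrite sumr_const -[X in _ * X]mulr_natl mulKf // pnatr_eq0 -lt0n.
Qed.

Lemma sum_smooth A T : (0 < #|T|)%N -> \sum_x smooth A T x = #|A|%:R.
Proof.
move=> T0; rewrite -mulr_sumr exchange_big /=.
under eq_bigr => t _ do rewrite sum_shift sum_favg //.
by rewrite sumr_const -[X in _ * X]mulr_natl mulKf // pnatr_eq0 -lt0n.
Qed.

(** Extending the correlation in [sqn_conv] from [diffs A] to all of [G] makes it factor into the
    square of the total mass. *)
Lemma sqn_conv_le A h : sidon A -> (forall x, 0 <= h x) ->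
  sqn (conv A h) <= #|A|%:R * sqn h + (\sum_x h x) ^+ 2.
Proof.
move=> sA h0; rewrite sqn_conv // lerD2l expr2 mulr_suml; apply: ler_sum => x _.
rewrite ler_wpM2l // -(sum_reflect x h) [leLHS]big_mkcond.
by apply: ler_sum => y _; case: ifP.
Qed.

Lemma sqn_avg T (F : G -> G -> R) (c : R) : (0 < #|T|)%N ->
  (forall v, v \in T -> sqn (F v) <= c) ->
  sqn (fun x => #|T|%:R^-1 * \sum_(v in T) F v x) <= c.
Proof.
move=> T0 le; have t0 : 0 < #|T|%:R :> R by rewrite ltr0n.
rewrite sqn_scale exprVn ler_pdivrMl ?exprn_gt0 //.
apply: (@le_trans _ _ (\sum_x #|T|%:R * \sum_(v in T) F v x ^+ 2)).
  by apply: ler_sum => x _; exact: sum_sqr_le.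
rewrite -mulr_sumr exchange_big /= expr2 -mulrA ler_wpM2l ?ler0n //.
by rewrite [leRHS]mulr_natl -sumr_const; apply: ler_sum => v vT; exact: le.
Qed.

Lemma sqn_smooth_le A T : (0 < #|T|)%N -> sqn (smooth A T) <= sqn (favg A T).
Proof.
move=> T0; apply: sqn_avg => // v _;
rewrite -[leRHS](sqn_sh (- v)) le_eqVlt; apply/orP; left; apply/eqP.
by apply: eq_sqn => x; rewrite /sh opprK.
Qed.

(** By commutativity it is [A] that convolves [ind T], so [sqn_conv_le] applies although [T] is
    arbitrary. The bound is at most 2 once [|A| <= |T|], which caps the energy iteration. *)
Lemma sqn_favg A T : sidon A -> (0 < #|T|)%N ->
  sqn (favg A T) <= #|A|%:R / #|T|%:R + 1.
Proof.
move=> sA T0; have t0 : 0 < #|T|%:R :> R by rewrite ltr0n.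
rewrite sqn_scale exprVn ler_pdivrMl ?exprn_gt0 //.
rewrite (eq_sqn (fun x => esym (conv_indC A T x))).
apply: le_trans (sqn_conv_le sA _) _ => [x|]; first by rewrite ler0n.
rewrite sqn_ind sum_ind le_eqVlt; apply/orP; left; apply/eqP; field.
by rewrite gt_eqF.
Qed.

Lemma smooth_invariant A T (e : R) t t' : (0 < #|T|)%N ->
  sqn (fun x => sh t (favg A T) x - sh t' (favg A T) x) <= e ->
  sqn (fun x => sh t (smooth A T) x - sh t' (smooth A T) x) <= e.
Proof.
move=> T0 le.
have -> : sqn (fun x => sh t (smooth A T) x - sh t' (smooth A T) x) =
  sqn (fun x => #|T|%:R^-1 * \sum_(v in T)
     sh (- v) (fun x => sh t (favg A T) x - sh t' (favg A T) x) x).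
  apply: eq_sqn => x; rewrite /sh /smooth -mulrBr -sumrB; congr (_ * _).
  by apply: eq_bigr => v _; rewrite opprK ![x + v - _]addrAC.
apply: sqn_avg => // v _; apply: le_trans le.
by rewrite (sqn_sh (- v) (fun x => sh t (favg A T) x - sh t' (favg A T) x)).
Qed.

(** Moving the average of [favg A T] over its translates across the inner product leaves
    autocorrelations of [favg A T] at shifts from [U - U]. *)
Lemma inner_smooth A T U :
  \sum_x smooth A U x * smooth A T x =
  #|U|%:R^-1 * \sum_(u' in U) (#|U|%:R^-1 * \sum_(u in U)
    \sum_x sh u' (favg A T) x * sh u (favg A T) x).
Proof.
transitivity (\sum_x #|U|%:R^-1 * \sum_(u' in U) (#|U|%:R^-1 * \sum_(u in U)
    ind R A (x + u' - u) * smooth A T x)).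
  apply: eq_bigr => x _; rewrite -mulrA; congr (_ * _).
  rewrite mulr_suml; apply: eq_bigr => u' _; rewrite -mulrA; congr (_ * _).
  by rewrite mulr_suml.
rewrite -mulr_sumr exchange_big; congr (_ * _); apply: eq_bigr => u' _.
rewrite -mulr_sumr exchange_big; congr (_ * _); apply: eq_bigr => u _ /=.
transitivity (\sum_x #|T|%:R^-1 * \sum_(v in T) ind R A (x + u' - u) * favg A T (x + v)).
  by apply: eq_bigr => x _; rewrite mulrCA mulr_sumr.
rewrite -mulr_sumr exchange_big /= mulr_sumr.
transitivity (\sum_x favg A T (x + u' - u) * favg A T x); last first.
  rewrite -(sum_shiftB u'); apply: eq_bigr => x _; rewrite /sh subrK.
  by rewrite mulrC.
under [RHS]eq_bigr => x _ do rewrite {1}/favg -mulrA mulr_suml mulr_sumr.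
rewrite exchange_big /=; apply: eq_bigr => v _.
rewrite -(sum_shiftB v) mulr_sumr; apply: eq_bigr => x _.
by rewrite subrK [x - v + _]addrAC [x + u' - v - _]addrAC.
Qed.

(** Let [q = sqn (favg A T)]. By [inner_smooth] and the invariance under [U], the cross term of the
    expanded square is at least [q - e / 2]. Since [sqn (smooth A T) <= q], replacing [q] by this
    energy gives the bound. *)
Lemma sqn_smooth_diff A T U (e : R) : (0 < #|T|)%N -> (0 < #|U|)%N ->
  (forall t t', t \in U -> t' \in U ->
    sqn (fun x => sh t (favg A T) x - sh t' (favg A T) x) <= e) ->
  sqn (fun x => smooth A U x - smooth A T x) <=
    sqn (smooth A U) - sqn (smooth A T) + e.
Proof.
move=> T0 U0 inv; have u0 : 0 < #|U|%:R :> R by rewrite ltr0n.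
set q := sqn (favg A T).
have avg_ge (F : G -> R) c : (forall u, u \in U -> c <= F u) ->
  c <= #|U|%:R^-1 * \sum_(u in U) F u.
  move=> h; rewrite ler_pdivlMl // [leLHS]mulr_natl -sumr_const.
  exact: ler_sum.
have lb : q - e / 2 <= \sum_x smooth A U x * smooth A T x.
  rewrite inner_smooth; apply: (avg_ge (fun u' => _)) => u' u'U; apply: avg_ge => u uU.
  have := inv _ _ u'U uU.
  have -> : sqn (fun x => sh u' (favg A T) x - sh u (favg A T) x) =
    q + q - 2 * \sum_x sh u' (favg A T) x * sh u (favg A T) x.
    rewrite /q -{1}(sqn_sh u' (favg A T)) -(sqn_sh u (favg A T)) mulr_sumr.
    by rewrite -big_split -sumrB /=; apply: eq_bigr => x _; ring.
  lra.
have -> : sqn (fun x => smooth A U x - smooth A T x) =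
  sqn (smooth A U) + sqn (smooth A T) - 2 * \sum_x smooth A U x * smooth A T x.
  by rewrite mulr_sumr -big_split -sumrB /=; apply: eq_bigr => x _; ring.
have := sqn_smooth_le A T0; rewrite -/q; lra.
Qed.

(** Where [f x >= th], either all five values of [g] are at least [th / 2], or one deviates from
    [f x] by more than [th / 2] and contributes over [th^2 / 4] to the squared distances. The latter
    happens for at most [5 e * 4 / th^2] points. *)
Lemma local_product f g (th e : R) (t : 'I_5 -> G) : 0 < th ->
  (forall x, 0 <= g x) ->
  (forall j, \sum_x (g (x + t j) - f x) ^+ 2 <= e) ->
  (th / 2) ^+ 5 * (#|[set x | th <= f x]|%:R - 20 / th ^+ 2 * e)
  <= \sum_x \prod_j g (x + t j).
Proof.
move=> th0 g0 le.
set E := [set x | th <= f x].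
have th2 : 0 < th / 2 by rewrite divr_gt0.
have pt x : ind R E x * (th / 2) ^+ 5 -
   (th / 2) ^+ 5 * (4 / th ^+ 2) * \sum_(j < 5) (g (x + t j) - f x) ^+ 2
   <= \prod_j g (x + t j).
  have P0 : 0 <= \prod_j g (x + t j) by apply: prodr_ge0.
  have S0 : 0 <= \sum_(j < 5) (g (x + t j) - f x) ^+ 2.
    by apply: sumr_ge0 => j _; exact: sqr_ge0.
  have c0 : 0 <= (th / 2) ^+ 5 * (4 / th ^+ 2).
    by rewrite mulr_ge0 ?exprn_ge0 ?divr_ge0 ?exprn_ge0 ?ltW.
  have [|nE] := boolP (x \in E); last first.
    rewrite /ind (negbTE nE) mul0r; have := mulr_ge0 c0 S0; lra.
  rewrite /ind => xE; rewrite xE mul1r; move: xE; rewrite inE => xE.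
  have [/forallP all|] := boolP [forall j, th / 2 <= g (x + t j)].
    apply: (@le_trans _ _ ((th / 2) ^+ 5)); first by have := mulr_ge0 c0 S0; lra.
    have <- : \prod_(j < 5) (th / 2) = (th / 2) ^+ 5 by rewrite prodr_const card_ord.
    apply: ler_prod => j _.
    by rewrite (ltW th2) all.
  rewrite negb_forall => /existsP[j]; rewrite -ltNge => bad.
  apply: le_trans P0; rewrite subr_le0 -mulrA ler_peMr ?exprn_ge0 ?(ltW th2) //.
  rewrite mulrAC ler_pdivlMr ?exprn_gt0 // mul1r.
  rewrite (bigD1 j) //=.
  have : 0 <= \sum_(i < 5 | i != j) (g (x + t i) - f x) ^+ 2.
    by apply: sumr_ge0 => i _; exact: sqr_ge0.
  have : 0 <= (f x - g (x + t j) - th / 2) * (f x - g (x + t j) + th / 2).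
    by rewrite mulr_ge0 //; lra.
  lra.
apply: le_trans (ler_sum _ (fun x _ => pt x)).
rewrite sumrB -mulr_suml -mulr_sumr sum_ind exchange_big /=.
have : \sum_(j < 5) \sum_x (g (x + t j) - f x) ^+ 2 <= 5 * e.
  have <- : \sum_(j < 5) e = 5 * e by rewrite sumr_const card_ord mulr_natl.
  by apply: ler_sum => j _.
set s := \sum_(j < 5) _ => ls.
have c0 : 0 <= (th / 2) ^+ 5 * (4 / th ^+ 2).
  by rewrite mulr_ge0 ?exprn_ge0 ?divr_ge0 ?exprn_ge0 ?ltW.
have := ler_wpM2l c0 ls; lra.
Qed.

End Energy.

(** * The weighted solution count and its stability under smoothing *)

Section Count.
Import ring lra.
Variables (R : realFieldType) (G : finZmodType).
Local Open Scope ring_scope.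
Implicit Types (f phi : G -> R) (A T U : {set G}).

(* [cnt f s] is the total weight of the solutions of [s + x1 + x2 + x3 + x4 = 4 x5]; as an
   iterate of [lin] it is visibly symmetric, since the operators [lin L f] commute. *)
Definition lin (L : G -> G) f phi : G -> R := fun s => \sum_y f y * phi (s + L y).
Definition m4 (y : G) : G := - (y *+ 4).
Definition delta0 : G -> R := fun s => (s == 0)%:R.
Definition cnt f : G -> R :=
  lin id f (lin id f (lin id f (lin id f (lin m4 f delta0)))).
Definition avg T (L : G -> G) phi : G -> R := fun s =>
  #|T|%:R^-1 * \sum_(v in T) (#|T|%:R^-1 * \sum_(t in T) phi (s + L (t - v))).

Lemma m4D x y : m4 (x + y) = m4 x + m4 y.
Proof. by rewrite /m4 mulrnDl opprD. Qed.

Lemma linC (L L' : G -> G) f g phi : lin L f (lin L' g phi) = lin L' g (lin L f phi).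
Proof.
apply: functional_extensionality => s; rewrite /lin.
under eq_bigr do rewrite mulr_sumr; rewrite exchange_big /=.
apply: eq_bigr => y _; rewrite mulr_sumr; apply: eq_bigr => x _.
by rewrite mulrCA addrAC.
Qed.

Lemma lin_avg T (L L' : G -> G) f phi :
  lin L f (avg T L' phi) = avg T L' (lin L f phi).
Proof.
apply: functional_extensionality => s; rewrite /lin /avg.
transitivity (\sum_y #|T|%:R^-1 * \sum_(v in T) (#|T|%:R^-1 *
   \sum_(t in T) (f y * phi (s + L' (t - v) + L y)))).
  apply: eq_bigr => y _; rewrite mulrCA; congr (_ * _); rewrite mulr_sumr.
  apply: eq_bigr => v _; rewrite mulrCA; congr (_ * _); rewrite mulr_sumr.
  by apply: eq_bigr => t _; rewrite addrAC.
rewrite -mulr_sumr exchange_big; congr (_ * _); apply: eq_bigr => v _.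
by rewrite -mulr_sumr exchange_big.
Qed.

(** The substitution [y := y + (t - v)] moves the smoothing from the weight to the argument of the
    count, where it becomes an average over translates by [L (t - v)]. *)
Lemma lin_smooth A T (L : G -> G) phi : (forall x y, L (x + y) = L x + L y) ->
  lin L (smooth R A T) phi = avg T L (lin L (ind R A) phi).
Proof.
move=> LD; apply: functional_extensionality => s; rewrite /lin /avg.
transitivity (\sum_y #|T|%:R^-1 * \sum_(v in T) (#|T|%:R^-1 *
   \sum_(t in T) (ind R A (y + v - t) * phi (s + L y)))).
  apply: eq_bigr => y _; rewrite -mulrA; congr (_ * _); rewrite mulr_suml.
  apply: eq_bigr => v _; rewrite -mulrA; congr (_ * _); by rewrite mulr_suml.
rewrite -mulr_sumr exchange_big; congr (_ * _); apply: eq_bigr => v _.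
rewrite -mulr_sumr exchange_big; congr (_ * _); apply: eq_bigr => t _ /=.
rewrite -(sum_shift (t - v)); apply: eq_bigr => y _.
by rewrite (LD y) [L y + _]addrC [s + (_ + _)]addrA [y + (t - v)]addrA subrK addrK.
Qed.

Definition stable T (e : R) phi := forall s u u', u \in T -> u' \in T ->
  phi (s + (u - u')) <= phi s + e.

Lemma avg_le T (L : G -> G) phi (e : R) s : (0 < #|T|)%N ->
  (forall u u', u \in T -> u' \in T -> phi (s + L (u - u')) <= phi s + e) ->
  avg T L phi s <= phi s + e.
Proof.
move=> T0 le; have t0 : 0 < #|T|%:R :> R by rewrite ltr0n.
rewrite /avg ler_pdivrMl // [leRHS]mulr_natl -[leRHS]sumr_const; apply: ler_sum => v vT.
rewrite ler_pdivrMl // [leRHS]mulr_natl -[leRHS]sumr_const; apply: ler_sum => t tT.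
exact: le.
Qed.

Lemma stable_avg T (L : G -> G) phi (e : R) : (0 < #|T|)%N ->
  stable T e phi -> stable T e (avg T L phi).
Proof.
move=> T0 st s u u' uT u'T; have t0 : 0 < #|T|%:R :> R by rewrite ltr0n.
rewrite -lerBlDl -mulrBr -sumrB ler_pdivrMl // [leRHS]mulr_natl -[leRHS]sumr_const.
apply: ler_sum => v vT; rewrite -mulrBr -sumrB ler_pdivrMl //.
rewrite [leRHS]mulr_natl -[leRHS]sumr_const.
by apply: ler_sum => t tT; rewrite lerBlDl [s + _ + _]addrAC st.
Qed.

(** Smoothing each of the four variables of coefficient 1 costs [e]. The variable of coefficient 4
    costs [4 e], since its shift is made of four steps from [T - T]. *)
Lemma cnt_smooth_le A T (e : R) s : (0 < #|T|)%N -> stable T e (cnt (ind R A)) ->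
  cnt (smooth R A T) s <= cnt (ind R A) s + 8 * e.
Proof.
move=> T0 st; rewrite /cnt !(lin_smooth, lin_avg) //; last exact: m4D.
rewrite -/(cnt (ind R A)); set C := cnt _ in st *.
have st4 : stable T e (avg T m4 C) by apply: stable_avg.
have step phi x : stable T e phi -> avg T id phi x <= phi x + e.
  by move=> h; apply: avg_le => // u u'; apply: h.
have l4 x : avg T m4 C x <= C x + 4 * e.
  apply: avg_le => // u u' uT u'T.
  have -> : m4 (u - u') = (u' - u) *+ 4 by rewrite /m4 -mulNrn opprB.
  have st' y := st y u' u u'T uT.
  have := st' x; have := st' (x + (u' - u)); have := st' (x + (u' - u) + (u' - u)).
  have := st' (x + (u' - u) + (u' - u) + (u' - u)).
  rewrite !mulrS mulr0n addr0 !addrA; lra.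
have s1 := stable_avg id T0 st4; have s2 := stable_avg id T0 s1.
have s3 := stable_avg id T0 s2.
have := step _ s s3; have := step _ s s2; have := step _ s s1; have := step _ s st4.
have := l4 s; lra.
Qed.

Lemma sum_delta0 f (L : G -> G) s t : (forall y, (s + L y == 0) = (y == t)) ->
  lin L f delta0 s = f t.
Proof.
move=> h; rewrite /lin (bigD1 t) //= /delta0 h eqxx mulr1 big1 ?addr0 // => y yt.
by rewrite h (negbTE yt) mulr0.
Qed.

Lemma lin_delta0 f s : lin id f delta0 s = f (- s).
Proof. by apply: sum_delta0 => y; rewrite addrC addr_eq0. Qed.

Lemma cntE f : cnt f =
  lin m4 f (lin id f (lin id f (lin id f (lin id f delta0)))).
Proof. by rewrite /cnt (linC id m4 f f delta0) !(linC id m4). Qed.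

Lemma cnt0E f : cnt f 0 = \sum_y \sum_y1 \sum_y2 \sum_y3
  f y * (f y1 * (f y2 * (f y3 * f (y *+ 4 - y1 - y2 - y3)))).
Proof.
rewrite cntE; apply: eq_bigr => y _; rewrite mulr_sumr; apply: eq_bigr => y1 _.
rewrite !mulr_sumr; apply: eq_bigr => y2 _; rewrite !mulr_sumr; apply: eq_bigr => y3 _.
by rewrite lin_delta0 add0r /m4 !opprD opprK.
Qed.

Lemma cnt_indE A s : cnt (ind R A) s = \sum_(x in A) \sum_(y in A)
  conv A (conv A (ind R A)) (x *+ 4 - y - s).
Proof.
rewrite cntE /lin sum_in_ind; apply: eq_bigr => x _; congr (_ * _).
rewrite sum_in_ind; apply: eq_bigr => y _; congr (_ * _).
rewrite /conv sum_in_ind; apply: eq_bigr => a _; congr (_ * _).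
rewrite sum_in_ind; apply: eq_bigr => b _; congr (_ * _).
rewrite -[LHS]/(lin id (ind R A) delta0 _) lin_delta0 !opprD /m4 opprK.
by rewrite [- s + _]addrC [_ - s - y]addrAC.
Qed.

(** The change in the count is the inner product of [w], a difference of translates of the triple
    convolution of [A], with a translate of the convolution of [-A] and the dilate of [A] by 4. As
    [-A] is Sidon and the dilate has [|A|] elements, the latter has squared norm at most
    [2 |A|^2]. *)
Lemma cnt_ind_stable A u u' (E k : R) s : sidon A ->
  injective (fun x : G => x *+ 4) -> 0 < k ->
  sqn (fun x => sh u (conv A (conv A (ind R A))) x
              - sh u' (conv A (conv A (ind R A))) x) <= E ->
  cnt (ind R A) (s + (u - u')) <=
  cnt (ind R A) s + (k * (2 * #|A|%:R ^+ 2) + k^-1 * E) / 2.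
Proof.
move=> sA inj4 k0; set K := conv A _; set w := fun x => _ => le.
pose B := [set x *+ 4 | x in A]; pose A' := [set - x | x in A].
have cA' : #|A'| = #|A| by rewrite card_imset //; exact: oppr_inj.
have sA' : sidon A'.
  move=> _ _ _ _ /imsetP[a aA ->] /imsetP[b bA ->] /imsetP[c cA ->] /imsetP[d dA ->].
  rewrite !opprK (inj_eq oppr_inj) => e ab; have ba : b != a by rewrite eq_sym.
  have e' : b - a = d - c by rewrite addrC e addrC.
  by have [-> ->] := sA _ _ _ _ bA aA dA cA e' ba.
have cB : #|B| = #|A| by rewrite card_imset.
rewrite -lerBlDl.
have -> : cnt (ind R A) (s + (u - u')) - cnt (ind R A) s =
  \sum_x w x * sh (u' - s) (conv A' (ind R B)) x.
  rewrite !cnt_indE -sumrB.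
  transitivity (\sum_(x in A) \sum_(y in A) w (x *+ 4 - y - s + u')).
    apply: eq_bigr => x _; rewrite -sumrB; apply: eq_bigr => y _.
    rewrite /w /sh addrK; congr (K _ - _).
    by rewrite opprD opprB addrA [u' - u]addrC !addrA addrAC.
  transitivity (\sum_(b in B) \sum_(y in A) w (b - y - s + u')).
    by rewrite big_imset //= => x y _ _; exact: inj4.
  rewrite exchange_big /=.
  transitivity (\sum_x \sum_(y in A') w x * ind R B (x - (u' - s) - y)).
    rewrite [RHS]exchange_big /= [RHS]big_imset /=; last by move=> ? ? _ _; exact: oppr_inj.
    apply: eq_bigr => y _; rewrite sum_in_ind.
    rewrite -[RHS](sum_shift (- y - s + u')); apply: eq_bigr => x _.
    rewrite mulrC !addrA; congr (w _ * ind _ _ _).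
    by rewrite opprK opprB !addrA [_ + u' + s]addrAC addrK !subrK.
  by apply: eq_bigr => x _; rewrite /sh /conv mulr_sumr.
have kk : 0 < k^-1 by rewrite invr_gt0.
apply: le_trans (inner_le_amgm _ _ kk) _.
rewrite invrK sqn_sh ler_wpM2r ?invr_ge0 //.
have l1 := ler_wpM2l (ltW kk) le.
have l2 : sqn (conv A' (ind R B)) <= 2 * #|A|%:R ^+ 2.
  apply: le_trans (sqn_conv_le sA' _) _ => [x|]; first by rewrite ler0n.
  by rewrite sqn_ind sum_ind cA' cB; lra.
have := ler_wpM2l (ltW k0) l2; lra.
Qed.

(* The shifts add up to 0, so the points [y + loop u1 u2 u3 u4 j] solve
   [x1 + x2 + x3 + x4 = 4 x5] for every [y]. *)
Definition loop (u1 u2 u3 u4 : G) (j : 'I_5) : G :=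
  nth 0 [:: 0; u1 - u2; u2 - u3; u3 - u4; u4 - u1] j.

(** By non-negativity the sums over [T] may run over [G]. For fixed [u4], the successive differences
    of the [ui] parametrise bijectively, together with [y], all solutions; the free [u4] accounts
    for the factor [|G|]. *)
Lemma sum_loop_le f T : (forall x, 0 <= f x) ->
  \sum_(u4 in T) \sum_(u3 in T) \sum_(u2 in T) \sum_(u1 in T)
    \sum_y \prod_j f (y + loop u1 u2 u3 u4 j) <= #|G|%:R * cnt f 0.
Proof.
move=> f0.
have sumT (F : G -> R) : (forall x, 0 <= F x) -> \sum_(x in T) F x <= \sum_x F x.
  by move=> h; rewrite [leLHS]big_mkcond; apply: ler_sum => x _; case: ifP.
have s0 (P : pred G) (F : G -> R) : (forall x, 0 <= F x) -> 0 <= \sum_(x | P x) F x.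
  by move=> h; apply: sumr_ge0.
pose H u1 u2 u3 u4 := \sum_y \prod_j f (y + loop u1 u2 u3 u4 j).
have H0 u1 u2 u3 u4 : 0 <= H u1 u2 u3 u4 by apply: s0 => y; apply: prodr_ge0.
apply: (@le_trans _ _ (\sum_u4 \sum_u3 \sum_u2 \sum_u1 H u1 u2 u3 u4)).
  apply: le_trans (sumT _ _) _ => [u4|].
    by do 3 (apply: (s0 _ _) => ?); exact: H0.
  apply: ler_sum => u4 _; apply: le_trans (sumT _ _) _ => [u3|].
    by do 2 (apply: (s0 _ _) => ?); exact: H0.
  apply: ler_sum => u3 _; apply: le_trans (sumT _ _) _ => [u2|].
    by apply: (s0 _ _) => ?; exact: H0.
  by apply: ler_sum => u2 _; apply: sumT => u1; exact: H0.
rewrite le_eqVlt; apply/orP; left; apply/eqP.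
transitivity (\sum_(u4 : G) cnt f 0); last by rewrite sumr_const mulr_natl.
apply: eq_bigr => u4 _; rewrite cnt0E.
transitivity (\sum_y \sum_t3 \sum_t2 \sum_t1
  f y * (f (y + t3) * (f (y + t2) * (f (y + t1) * f (y - t3 - t2 - t1))))).
  rewrite [RHS]exchange_big -(sum_shift u4); apply: eq_bigr => t3 _ /=.
  rewrite [RHS]exchange_big -(sum_shift (t3 + u4)); apply: eq_bigr => t2 _ /=.
  rewrite [RHS]exchange_big -(sum_shift (t2 + (t3 + u4))); apply: eq_bigr => t1 _ /=.
  apply: eq_bigr => y _; rewrite !big_ord_recl big_ord0 /loop /= addr0 !addrK mulr1.
  have -> : y + (u4 - (t1 + (t2 + (t3 + u4)))) = y - t3 - t2 - t1.
    by rewrite addrA [t2 + _]addrA !opprD; move: (- t1) (- t2) (- t3) => a b c;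
    rewrite !addrA; do 3 rewrite [_ + u4 + _]addrAC; rewrite addrK -!addrA; congr (_ + _);
    rewrite addrC -addrA addrCA [b + a]addrC.
  by ring.
apply: eq_bigr => y _; rewrite -[RHS](sum_shift y); apply: eq_bigr => t3 _.
rewrite -[RHS](sum_shift y); apply: eq_bigr => t2 _.
rewrite -[RHS](sum_shift y); apply: eq_bigr => t1 _.
rewrite ![_ + y]addrC; do 4 congr (_ * _); congr (f _).
rewrite !opprD !addrA [_ - t3 - y]addrAC [_ - t2 - y]addrAC [_ - t3 - y]addrAC.
by rewrite !mulrS mulr0n addr0 !addrA !addrK.
Qed.

End Count.

(** * Energy increment: a dense Sidon set has many solutions *)

Section Iteration.
Import ring lra.
Variable R : archiRealFieldType.
Local Open Scope ring_scope.

Lemma card_sidon_fiber (G : finZmodType) (A : {set G}) (z : G) : sidon A ->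
  (#|[set b in A | (z - b)%R \in A]| <= 2)%N.
Proof.
move=> sA; have [->|[a]] := set_0Vmem [set b in A | z - b \in A]; first by rewrite cards0.
rewrite inE => /andP[aA zaA]; apply: (@leq_trans #|[set a; z - a]|).
  apply/subset_leq_card/subsetP => b; rewrite !inE => /andP[bA zbA].
  have [//|ab] := eqVneq b a.
  have e : a - b = (z - b) - (z - a) by rewrite opprB [RHS]addrC addrA subrK.
  by rewrite eq_sym in ab; have [-> _] := sA _ _ _ _ aA bA zbA zaA e ab; rewrite subKr eqxx.
by rewrite cards2; case: (_ != _).
Qed.

Lemma conv_sidon_bounds (G : finZmodType) (A : {set G}) x : sidon A ->
  0 <= conv A (ind R A) x <= 2.
Proof.
move=> sA; rewrite sumr_ge0 => [|a _]; last by rewrite ler0n.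
have -> : conv A (ind R A) x = #|[set b in A | x - b \in A]|%:R.
  rewrite -sum_ind /conv sum_in_ind; apply: eq_bigr => a _.
  by rewrite /ind inE -natrM mulnb.
by rewrite /= ler_nat card_sidon_fiber.
Qed.

Lemma card_gt1_dense (G : finZmodType) (A : {set G}) (delta : R) : 0 < delta ->
  4 / delta <= #|G|%:R -> delta * #|G|%:R <= #|A|%:R ^+ 2 -> (1 < #|A|)%N.
Proof.
move=> d0 G4 dA; have d4 : 4 <= delta * #|G|%:R by rewrite -ler_pdivrMl // mulrC.
rewrite -(@ltr_nat R) ltNge; apply/negP => le1.
have : #|A|%:R ^+ 2 <= 1 :> R by rewrite expr_le1 ?ler0n.
lra.
Qed.

Lemma sidon_card_le_dense (G : finZmodType) (A T : {set G}) (tau : R) : 0 < tau ->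
  sidon A -> (1 < #|A|)%N -> 2 / tau ^+ 2 <= #|G|%:R -> tau * #|G|%:R <= #|T|%:R ->
  (#|A| <= #|T|)%N.
Proof.
move=> t0 sA A1 G2 tT; rewrite -(@ler_nat R); apply: le_trans tT.
have aN := sidon_card_sqr R sA A1.
have t2 : 2 <= tau ^+ 2 * #|G|%:R by rewrite -ler_pdivrMl ?exprn_gt0 // mulrC.
rewrite -(@ler_pXn2r _ 2) ?nnegrE ?ler0n ?mulr_ge0 ?(ltW t0) //.
have := ler_wpM2r (ler0n R #|G|) t2; lra.
Qed.

(** Values below half the mean carry at most half of the total mass [|A|]. The rest lies on the
    level set, and Cauchy-Schwarz with energy at most 2 bounds its size from below. *)
Lemma card_level_smooth (G : finZmodType) (A T : {set G}) : sidon A ->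
  (0 < #|T|)%N -> (#|A| <= #|T|)%N ->
  #|A|%:R ^+ 2 / 8 <=
    #|[set x | #|A|%:R / (2 * #|G|%:R) <= smooth R A T x]|%:R :> R.
Proof.
move=> sA T0 AT; set a := #|A|%:R; set N := #|G|%:R; set E := [set x | _].
have N0 : 0 < N by rewrite ltr0n; apply: leq_trans T0 (max_card _).
have t0 : 0 < #|T|%:R :> R by rewrite ltr0n.
have s2 : sqn (smooth R A T) <= 2.
  apply: le_trans (sqn_smooth_le _ _ T0) _; apply: le_trans (sqn_favg _ sA T0) _.
  have : #|A|%:R / #|T|%:R <= 1 :> R by rewrite ler_pdivrMr // mul1r ler_nat.
  lra.
have aE : a / 2 <= \sum_(x in E) smooth R A T x.
  have : a <= \sum_(x in E) smooth R A T x + N * (a / (2 * N)).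
    have -> : N * (a / (2 * N)) = \sum_(x : G) a / (2 * N) by rewrite sumr_const [LHS]mulr_natl.
    apply: (@le_trans _ _ (\sum_x smooth R A T x)); first by rewrite sum_smooth.
    rewrite [X in _ <= X + _]big_mkcond -big_split; apply: ler_sum => x _ /=; rewrite inE.
    by case: (leP (a / (2 * N))) => [_|/ltW le]; rewrite ?add0r //
       lerDl divr_ge0 ?mulr_ge0 ?ler0n.
  have -> : N * (a / (2 * N)) = a / 2 by field; rewrite gt_eqF.
  lra.
have cs := @sum_sqr_le R G (mem E) (smooth R A T).
have q2 : \sum_(x in E) smooth R A T x ^+ 2 <= 2.
  apply: le_trans s2; rewrite [leLHS]big_mkcond; apply: ler_sum => x _.
  by case: ifP => // _; exact: sqr_ge0.
have a0 : 0 <= a / 2 by rewrite divr_ge0 ?ler0n.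
have sq : (a / 2) ^+ 2 <= (\sum_(x in E) smooth R A T x) ^+ 2.
  by rewrite lerXn2r // nnegrE // (le_trans a0).
have := ler_wpM2l (ler0n R #|E|) q2.
have e1 : #|mem E|%:R = #|E|%:R :> R by [].
rewrite e1 in cs; lra.
Qed.

(** All shifts in [loop] lie in [V - V], so [local_product] applies on the level set of
    [smooth A T]. Summing over the four shift parameters in [V] and using [sum_loop_le] yields the
    count. *)
Lemma smooth_count_ge (G : finZmodType) (A T V U : {set G}) (delta c e : R) :
  0 < delta -> 0 < c -> sidon A -> (0 < #|A|)%N -> (#|A| <= #|T|)%N ->
  delta * #|G|%:R <= #|A|%:R ^+ 2 -> c * #|G|%:R <= #|V|%:R ->
  (forall t t', t \in V -> t' \in V ->
    sqn (fun x => sh t (smooth R A T) x - sh t' (smooth R A T) x) <= e) ->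
  2 * sqn (fun x => smooth R A U x - smooth R A T x) + 2 * e <= delta ^+ 2 / 1280 ->
  c ^+ 4 * delta ^+ 2 / 16384 * #|A|%:R ^+ 3 <= cnt (smooth R A U) 0.
Proof.
move=> d0 c0 sA A0 AT dA cV inv close.
have T0 : (0 < #|T|)%N by exact: leq_trans AT.
have lev := card_level_smooth sA T0 AT.
set a := (#|A|%:R : R) in dA lev *; set N := (#|G|%:R : R) in dA cV lev *.
have a0 : 0 < a by rewrite ltr0n.
have N0 : 0 < N by rewrite ltr0n; apply: leq_trans A0 (max_card _).
set th := a / (2 * N) in lev; have th0 : 0 < th by rewrite divr_gt0 ?mulr_gt0.
have prod_ge u1 u2 u3 u4 : u1 \in V -> u2 \in V -> u3 \in V -> u4 \in V ->
  (a / (4 * N)) ^+ 5 * (a ^+ 2 / 16) <=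
    \sum_y \prod_j smooth R A U (y + loop u1 u2 u3 u4 j).
  move=> v1 v2 v3 v4.
  have loopV j : exists u u', [/\ u \in V, u' \in V & loop u1 u2 u3 u4 j = u - u'].
    case: j => [[|[|[|[|[|//]]]]] ?]; rewrite /loop /=.
    - by exists u1, u1; rewrite subrr.
    - by exists u1, u2.
    - by exists u2, u3.
    - by exists u3, u4.
    - by exists u4, u1.
  have dist j : \sum_x (smooth R A U (x + loop u1 u2 u3 u4 j) - smooth R A T x) ^+ 2
     <= delta ^+ 2 / 1280.
    have [u [u' [uV u'V ->]]] := loopV j; apply: le_trans close.
    apply: le_trans (_ : _ <= 2 * sqn (fun x =>
        smooth R A U (x + (u - u')) - smooth R A T (x + (u - u'))) +
      2 * sqn (fun x => smooth R A T (x + (u - u')) - smooth R A T x)) _.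
      exact: sqn_triangle.
    rewrite (_ : sqn _ = sqn (fun x => smooth R A U x - smooth R A T x)); last first.
      exact: (sum_shift (u - u') (fun x => (smooth R A U x - smooth R A T x) ^+ 2)).
    rewrite lerD2l ler_wpM2l // -(sqn_sh u).
    rewrite (_ : sqn _ = sqn (fun x => sh u' (smooth R A T) x - sh u (smooth R A T) x)) ?inv //.
    by apply: eq_sqn => x; rewrite /sh addrA subrK.
  apply: le_trans (local_product th0 (smooth_ge0 R A U) dist).
  have -> : th / 2 = a / (4 * N) by rewrite /th; field; rewrite gt_eqF.
  rewrite ler_wpM2l ?exprn_ge0 ?divr_ge0 ?mulr_ge0 ?(ltW N0) ?(ltW a0) //.
  (* The constant 1280 lets the exceptional points remove at most [|A|^2 / 16], half of the bound in
     [card_level_smooth]. *)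
  have -> : 20 / th ^+ 2 * (delta ^+ 2 / 1280) = (delta * N) ^+ 2 / (16 * a ^+ 2).
    by rewrite /th; field; rewrite !gt_eqF.
  have : (delta * N) ^+ 2 / (16 * a ^+ 2) <= a ^+ 2 / 16.
    rewrite ler_pdivrMr ?mulr_gt0 ?exprn_gt0 //.
    have : (delta * N) ^+ 2 <= (a ^+ 2) ^+ 2.
      by rewrite lerXn2r // nnegrE ?exprn_ge0 ?mulr_ge0 ?ltW.
    lra.
  lra.
have tot := sum_loop_le V (smooth_ge0 R A U).
have low : #|V|%:R ^+ 4 * ((a / (4 * N)) ^+ 5 * (a ^+ 2 / 16)) <=
  N * cnt (smooth R A U) 0.
  apply: le_trans tot; set q := _ * (a ^+ 2 / 16) in prod_ge *.
  have cst (F : G -> R) r : (forall u, u \in V -> r <= F u) ->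
     #|V|%:R * r <= \sum_(u in V) F u.
    by move=> h; rewrite mulr_natl -sumr_const; apply: ler_sum.
  rewrite !exprS expr0 mulr1 -!mulrA.
  apply: (cst _ _) => u4 v4; apply: (cst _ _) => u3 v3.
  apply: (cst _ _) => u2 v2; apply: (cst _ _) => u1 v1.
  exact: prod_ge.
rewrite -(ler_pM2l N0); apply: le_trans low.
have cV4 : (c * N) ^+ 4 <= #|V|%:R ^+ 4.
  by rewrite lerXn2r // nnegrE ?mulr_ge0 ?ler0n ?ltW.
have q0 : 0 <= (a / (4 * N)) ^+ 5 * (a ^+ 2 / 16).
  by rewrite mulr_ge0 ?exprn_ge0 ?divr_ge0 ?exprn_ge0 ?mulr_ge0 ?(ltW N0) ?(ltW a0).
apply: le_trans (ler_wpM2r q0 cV4).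
have -> : (c * N) ^+ 4 * ((a / (4 * N)) ^+ 5 * (a ^+ 2 / 16)) =
  c ^+ 4 / 16384 * a ^+ 3 * ((a ^+ 2) ^+ 2 / N).
  by field; rewrite gt_eqF.
have -> : N * (c ^+ 4 * delta ^+ 2 / 16384 * a ^+ 3) =
  c ^+ 4 / 16384 * a ^+ 3 * ((delta * N) ^+ 2 / N).
  by field; rewrite gt_eqF.
have p0 : 0 <= c ^+ 4 / 16384 * a ^+ 3 by rewrite ltW // mulr_gt0 ?divr_gt0 ?exprn_gt0.
apply: ler_wpM2l => //; apply: ler_wpM2r; first by rewrite invr_ge0 ltW.
by rewrite lerXn2r // nnegrE ?exprn_ge0 ?mulr_ge0 ?ltW.
Qed.

Lemma favg_invariant (G : finZmodType) (A T V : {set G}) (e : R) : (0 < #|T|)%N ->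
  (forall t t', t \in V -> t' \in V ->
    sqn (fun x => conv A (sh t (ind R T)) x - conv A (sh t' (ind R T)) x)
      <= e * #|T|%:R ^+ 2) ->
  forall t t', t \in V -> t' \in V ->
    sqn (fun x => sh t (favg R A T) x - sh t' (favg R A T) x) <= e.
Proof.
move=> T0 per t t' tV t'V; have t0 : 0 < #|T|%:R :> R by rewrite ltr0n.
have -> : sqn (fun x => sh t (favg R A T) x - sh t' (favg R A T) x) =
  sqn (fun x => #|T|%:R^-1 *
    (conv A (sh t (ind R T)) x - conv A (sh t' (ind R T)) x)).
  by apply: eq_sqn => x; rewrite !conv_sh /sh /favg !(conv_indC R A T) mulrBr.
by rewrite sqn_scale exprVn ler_pdivrMl ?exprn_gt0 // mulrC per.
Qed.

(** The dichotomy carried through the iteration; its second alternative becomes impossible once [E]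
    exceeds 2. *)
Definition counts_or_energy (delta c tau E : R) (N0 : nat) :=
  forall (G : finZmodType) (A : {set G}), (N0 <= #|G|)%N ->
  injective (fun x : G => x *+ 4) -> sidon A ->
  delta * #|G|%:R <= #|A|%:R ^+ 2 ->
  c * #|A|%:R ^+ 3 <= cnt (ind R A) 0 \/
  exists2 T : {set G}, tau * #|G|%:R <= #|T|%:R & E <= sqn (smooth R A T).

(** Given [T], take almost-periods [V] for its convolution with [A], and inside [V] almost-periods
    [U] for the triple convolution of [A]. If [U] does not gain energy over [T], the two smoothings
    are close, so [smooth A U] has many solutions, and stability under [U] transfers them to [A]. *)
Lemma energy_increment (delta c tau E : R) (N0 : nat) :
  0 < delta -> 0 < c -> 0 < tau -> counts_or_energy delta c tau E N0 ->
  exists c' tau' : R, exists N0' : nat,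
  [/\ 0 < c', 0 < tau' & counts_or_energy delta c' tau' (E + delta ^+ 2 / 5120) N0'].
Proof.
move=> d0 c0 t0 IH.
(* Without the gain [delta^2 / 5120], closeness costs at most [2 (delta^2 / 5120 + e2) + 2 e2 =
   delta^2 / 1280]. The factor [tau^2] below offsets the division by [|T|^2] in [favg]. *)
pose e2 := delta ^+ 2 / 10240; have e2E : e2 = delta ^+ 2 / 10240 by [].
have e20 : 0 < e2 by rewrite divr_gt0 ?exprn_gt0.
clearbody e2; have e2t : 0 < e2 * tau ^+ 2 by rewrite mulr_gt0 ?exprn_gt0.
have [c1 c10 [N1 AP1]] := sidon_almost_periods d0 e2t.
pose cs := c1 ^+ 4 * delta ^+ 2 / 16384.
have cs0 : 0 < cs by rewrite divr_gt0 ?mulr_gt0 ?exprn_gt0.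
(* Stability holds with error [2 k |A|^3], so the loss in [cnt_smooth_le] is [16 k |A|^3], half of
   the main term. The choice of [e1] balances the two terms of [cnt_ind_stable] at weight
   [k |A|]. *)
pose k := cs / 32; have kE : k = cs / 32 by [].
have k0 : 0 < k by rewrite divr_gt0.
clearbody k.
pose e1 := 2 * k ^+ 2 * delta ^+ 2; have e1E : e1 = 2 * k ^+ 2 * delta ^+ 2 by [].
have e10 : 0 < e1.
  by apply: mulr_gt0; [apply: mulr_gt0|]; rewrite ?exprn_gt0.
clearbody e1; have [c2 c20 [N2 AP2]] := sidon_almost_periods d0 e10.
have [n3 H3] := natr_bound (2 / tau ^+ 2).
have [n4 H4] := natr_bound (4 / delta).
exists (Num.min c (cs / 2)), (c2 * c1),
  (maxn N0 (maxn N1 (maxn N2 (maxn n3 (maxn n4 1))))); split.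
- by rewrite lt_min c0 divr_gt0.
- by rewrite mulr_gt0.
move=> G A; rewrite !geq_max => /and5P[l0 l1 l2 l3 /andP[l4 l5]] inj4 sA dA.
have N0' : 0 < #|G|%:R :> R by rewrite ltr0n.
have A1 : (1 < #|A|)%N := card_gt1_dense d0 (H4 _ l4) dA.
have A0 : (0 < #|A|)%N by exact: ltnW.
have a0 : 0 < #|A|%:R :> R by rewrite ltr0n.
have a30 : 0 <= #|A|%:R ^+ 3 :> R by rewrite exprn_ge0 ?ltW.
have [cn|[T tT ET]] := IH G A l0 inj4 sA dA.
  by left; apply: le_trans cn; rewrite ler_wpM2r // ge_min lexx.
have T0 : (0 < #|T|)%N by rewrite -(@ltr0n R); apply: lt_le_trans tT; rewrite mulr_gt0.
have AT : (#|A| <= #|T|)%N := sidon_card_le_dense t0 sA A1 (H3 _ l3) tT.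
have h01 x : 0 <= ind R T x <= 2.
  by rewrite /ind; case: (x \in T); rewrite ?lexx ?ler0n ?ler1n ?ler_nat.
have [V [_ V1 per1]] := AP1 G A [set: G] (ind R T) l1 sA dA h01.
rewrite cardsT in V1.
have [U [UV U1 per2]] := AP2 G A V _ l2 sA dA (fun x => conv_sidon_bounds x sA).
have U2 : c2 * c1 * #|G|%:R <= #|U|%:R.
  by apply: le_trans U1; rewrite -mulrA ler_wpM2l // ltW.
have [inc|noinc] := leP (E + delta ^+ 2 / 5120) (sqn (smooth R A U)).
  by right; exists U.
left.
have U0 : (0 < #|U|)%N.
  by rewrite -(@ltr0n R); apply: lt_le_trans U2; rewrite !mulr_gt0.
have inv : forall t t', t \in V -> t' \in V ->
    sqn (fun x => sh t (favg R A T) x - sh t' (favg R A T) x) <= e2.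
  apply: favg_invariant => // t t' tV t'V; apply: le_trans (per1 _ _ tV t'V) _.
  rewrite -mulrA ler_wpM2l ?(ltW e20) // -exprMn.
  by rewrite lerXn2r // nnegrE ?mulr_ge0 ?ler0n ?ltW.
have invU t t' (tU : t \in U) (t'U : t' \in U) :=
  inv t t' (subsetP UV _ tU) (subsetP UV _ t'U).
have close := sqn_smooth_diff T0 U0 invU.
have lower : cs * #|A|%:R ^+ 3 <= cnt (smooth R A U) 0.
  apply: (@smooth_count_ge G A T V U delta c1 e2) => //.
    by move=> t t' tV t'V; apply: smooth_invariant => //; apply: inv.
  by move: close ET noinc; rewrite e2E; clear; lra.
have st : stable U (2 * k * #|A|%:R ^+ 3) (cnt (ind R A)).
  move=> s u u' uU u'U.
  have ka : 0 < k * #|A|%:R by rewrite mulr_gt0.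
  have per : sqn (fun x => sh u (conv A (conv A (ind R A))) x
              - sh u' (conv A (conv A (ind R A))) x) <= e1 * #|G|%:R ^+ 2.
    apply: le_trans (per2 _ _ uU u'U); rewrite le_eqVlt; apply/orP; left; apply/eqP.
    by apply: eq_sqn => x; rewrite !conv_sh.
  apply: le_trans (cnt_ind_stable s sA inj4 ka per) _; rewrite lerD2l.
  have dN : (delta * #|G|%:R) ^+ 2 <= (#|A|%:R ^+ 2) ^+ 2 :> R.
    by rewrite lerXn2r // nnegrE ?exprn_ge0 ?mulr_ge0 ?(ltW d0) ?(ltW N0') ?(ltW a0).
  have -> : (k * #|A|%:R)^-1 * (e1 * #|G|%:R ^+ 2) =
    2 * k / #|A|%:R * (delta * #|G|%:R) ^+ 2.
    by rewrite e1E; field; rewrite !gt_eqF.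
  have kA : 0 <= 2 * k / #|A|%:R by rewrite divr_ge0 ?mulr_ge0 ?(ltW k0) ?(ltW a0).
  have := ler_wpM2l kA dN.
  have -> : 2 * k / #|A|%:R * (#|A|%:R ^+ 2) ^+ 2 = 2 * k * #|A|%:R ^+ 3.
    by field; rewrite gt_eqF.
  by clear; lra.
have upper := cnt_smooth_le 0 U0 st.
apply: (@le_trans _ _ (cs / 2 * #|A|%:R ^+ 3)).
  by rewrite ler_wpM2r // ge_min lexx orbT.
by move: lower upper; rewrite kE; clear; lra.
Qed.

(** Start from [T = G] with energy at least 0 and iterate until the energy would reach 3, against
    the bound 2 from [sqn_favg]. *)
Theorem sidon_count (delta : R) : 0 < delta ->
  exists2 c : R, 0 < c & exists N0 : nat,
  forall (G : finZmodType) (A : {set G}), (N0 <= #|G|)%N ->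
  injective (fun x : G => x *+ 4) -> sidon A ->
  delta * #|G|%:R <= #|A|%:R ^+ 2 -> c * #|A|%:R ^+ 3 <= cnt (ind R A) 0.
Proof.
move=> d0; pose eta := delta ^+ 2 / 5120.
have eta0 : 0 < eta by rewrite divr_gt0 ?exprn_gt0.
have iter (k : nat) : exists c tau : R, exists N0 : nat,
    [/\ 0 < c, 0 < tau & counts_or_energy delta c tau (eta *+ k) N0].
  elim: k => [|k [c [tau [N0 [c0 t0 IH]]]]].
    exists 1, 1, 0%N; split=> // G A _ _ _ _; right; exists [set: G].
      by rewrite cardsT mul1r.
    by rewrite mulr0n sqn_ge0.
  by rewrite mulrSr; apply: energy_increment IH.
have [k /(_ k (leqnn k)) Hk] := natr_bound (3 / eta).
have k3 : 3 <= eta *+ k by rewrite -[leRHS]mulr_natr -ler_pdivrMl // mulrC.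
have [c [tau [N0 [c0 t0 IH]]]] := iter k.
exists c => //.
have [n3 H3] := natr_bound (2 / tau ^+ 2).
have [n4 H4] := natr_bound (4 / delta).
exists (maxn N0 (maxn n3 (maxn n4 1))) => G A.
rewrite !geq_max => /and4P[l0 l3 l4 l5] inj4 sA dA.
have [//|[T tT ET]] := IH G A l0 inj4 sA dA.
exfalso.
have N0' : 0 < #|G|%:R :> R by rewrite ltr0n.
have T0 : (0 < #|T|)%N by rewrite -(@ltr0n R); apply: lt_le_trans tT; rewrite mulr_gt0.
have A1 : (1 < #|A|)%N := card_gt1_dense d0 (H4 _ l4) dA.
have AT : #|A|%:R / #|T|%:R <= 1 :> R.
  rewrite ler_pdivrMr ?ltr0n // mul1r ler_nat.
  exact: sidon_card_le_dense t0 sA A1 (H3 _ l3) tT.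
have := sqn_smooth_le R A T0; have := sqn_favg R sA T0; lra.
Qed.

End Iteration.

(** * Solutions with a repeated variable *)

Section Degenerate.
Import ring lra.
Variables (R : archiRealFieldType) (G : finZmodType) (A : {set G}).
Local Open Scope ring_scope.
Hypothesis sA : sidon A.

(** Once [p] and [q] are chosen, the sum [r + w] is fixed, and a sum has at most two ordered
    representations in a Sidon set. *)
Lemma card_class_le (I : finType) (X : {set I}) (p q r w : I -> G)
    (z : G -> G -> G) :
  (forall x, x \in X -> [/\ p x \in A, q x \in A, r x \in A & w x \in A]) ->
  (forall x, x \in X -> r x + w x = z (p x) (q x)) ->
  {in X &, forall x y, p x = p y -> q x = q y -> r x = r y -> w x = w y -> x = y} ->
  (#|X| <= 2 * #|A| ^ 2)%N.
Proof.
move=> inA eqz inj.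
have -> : #|X| = #|[set (p x, q x, r x) | x in X]|.
  rewrite card_in_imset // => x y xX yX [ep eq er].
  by apply: inj => //; apply: (addrI (r x)); rewrite {2}er !eqz // ep eq.
apply: (@leq_trans (\sum_(u in setX A A) #|[set b in A | (z u.1 u.2 - b)%R \in A]|)).
  rewrite -[leqLHS]sum1_card.
  under [X in (_ <= X)%N]eq_bigr => u _ do rewrite -sum1_card.
  rewrite (pair_big_dep (mem (setX A A))
    (fun u b => b \in [set b in A | (z u.1 u.2 - b)%R \in A]) (fun _ _ => 1%N)) /=.
  rewrite [leqLHS]big_mkcond [leqRHS]big_mkcond; apply: leq_sum => -[[a b] c] _ /=.
  case: imsetP => // -[x xX [-> -> ->]]; have [pA qA rA wA] := inA x xX.
  by rewrite !inE pA qA rA /= -(eqz _ xX) addrC addKr wA.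
apply: (@leq_trans (\sum_(u in setX A A) 2)).
  by apply: leq_sum => u _; exact: card_sidon_fiber.
by rewrite sum_nat_const cardsX mulnC mulnn.
Qed.

(** Each of the ten possible coincidences among five variables falls under [card_class_le], giving
    [10 * 2 = 20]. *)
Lemma cnt_degenerate_le :
  (forall x1 x2 x3 x4 x5, x1 \in A -> x2 \in A -> x3 \in A -> x4 \in A -> x5 \in A ->
     x1 + x2 + x3 + x4 = x5 *+ 4 -> ~~ uniq [:: x1; x2; x3; x4; x5]) ->
  cnt (ind R A) 0 <= 20 * #|A|%:R ^+ 2.
Proof.
move=> noU.
pose x5 (x : G * G * G * G) := x.1.1.1; pose x1 (x : G * G * G * G) := x.1.1.2.
pose x2 (x : G * G * G * G) := x.1.2; pose x3 (x : G * G * G * G) := x.2.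
pose x4 x := x5 x *+ 4 - x1 x - x2 x - x3 x.
pose X := [set x | [&& x5 x \in A, x1 x \in A, x2 x \in A, x3 x \in A & x4 x \in A]].
have -> : cnt (ind R A) 0 = #|X|%:R.
  rewrite cnt0E !pair_bigA /= -sum1_card natr_sum [RHS]big_mkcond; apply: eq_bigr => x _.
  by rewrite /ind inE -!natrM !mulnb; case: ifP.
pose P x := [:: x1 x == x2 x; x1 x == x3 x; x2 x == x3 x; x1 x == x4 x; x2 x == x4 x;
  x3 x == x4 x; x1 x == x5 x; x2 x == x5 x; x3 x == x5 x; x4 x == x5 x].
pose C (k : 'I_10) := [set x in X | nth false (P x) k].
have eqX x : x1 x + x2 x + x3 x + x4 x = x5 x *+ 4.
  rewrite /x4; move: (x5 x *+ 4) (x1 x) (x2 x) (x3 x) => s a b c.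
  rewrite addrC !addrA [_ - c + a]addrAC [_ - b + a]addrAC subrK.
  by rewrite [_ - c + b]addrAC !subrK.
have cover : (#|X| <= \sum_k #|C k|)%N.
  have -> : (\sum_k #|C k| = \sum_(x in X) \sum_k (nth false (P x) (k : 'I_10)))%N.
    rewrite exchange_big /=; apply: eq_bigr => k _.
    rewrite -sum1_card big_mkcond [RHS]big_mkcond; apply: eq_bigr => x _.
    by rewrite inE; case: (x \in X) => //=; case: nth.
  rewrite -sum1_card; apply: leq_sum => x; rewrite inE => /and5P[m5 m1 m2 m3 m4].
  have := noU _ _ _ _ _ m1 m2 m3 m4 m5 (eqX x).
  rewrite !big_ord_recl big_ord0 /= !inE.
  by case: (x1 x == x2 x); case: (x1 x == x3 x); case: (x2 x == x3 x);
     case: (x1 x == x4 x); case: (x2 x == x4 x); case: (x3 x == x4 x);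
     case: (x1 x == x5 x); case: (x2 x == x5 x); case: (x3 x == x5 x);
     case: (x4 x == x5 x).
have inX k x : x \in C k -> [/\ x5 x \in A, x1 x \in A, x2 x \in A, x3 x \in A & x4 x \in A].
  by rewrite !inE => /andP[/and5P].
have class k : (#|C k| <= 2 * #|A| ^ 2)%N.
  have ext x y : x5 x = x5 y -> x1 x = x1 y -> x2 x = x2 y -> x3 x = x3 y -> x = y.
    by move: x y => [[[? ?] ?] ?] [[[? ?] ?] ?]; rewrite /x5 /x1 /x2 /x3 /= => -> -> -> ->.
  have E34 x : x3 x + x4 x = x5 x *+ 4 - x1 x - x2 x.
    by rewrite addrC subrK.
  have E24 x : x2 x + x4 x = x5 x *+ 4 - x1 x - x3 x.
    by rewrite addrC /x4 addrAC subrK.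
  have E14 x : x1 x + x4 x = x5 x *+ 4 - x2 x - x3 x.
    by rewrite addrC /x4 addrAC [_ - x2 x + _]addrAC subrK.
  have E23 x : x2 x + x3 x = x5 x *+ 4 - x1 x - x4 x.
    by rewrite -eqX [_ - x1 x - _]addrAC addrK [x1 x + _]addrC [x2 x + _ + _]addrAC addrK.
  have E13 x : x1 x + x3 x = x5 x *+ 4 - x2 x - x4 x.
    by rewrite -eqX [_ - x2 x - _]addrAC addrK [x1 x + _ + _]addrAC addrK.
  have E12 x : x1 x + x2 x = x5 x *+ 4 - x3 x - x4 x.
    by rewrite -eqX [_ - x3 x - _]addrAC !addrK.
  have Ceq i x : x \in C i -> nth false (P x) i by rewrite inE => /andP[].
  have cls i (p q r w : G * G * G * G -> G) z :
     (forall x, x \in C i -> [/\ p x \in A, q x \in A, r x \in A & w x \in A]) ->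
     (forall x, nth false (P x) i -> r x + w x = z (p x) (q x)) ->
     (forall x y, nth false (P x) i -> nth false (P y) i ->
       p x = p y -> q x = q y -> r x = r y -> w x = w y ->
       [/\ x5 x = x5 y, x1 x = x1 y, x2 x = x2 y & x3 x = x3 y]) ->
     (#|C i| <= 2 * #|A| ^ 2)%N.
    move=> h1 h2 h3; apply: (@card_class_le _ _ p q r w z) => //.
      by move=> x /Ceq /h2.
    move=> x y xC yC e1 e2 e3 e4.
    by have [? ? ? ?] := h3 x y (Ceq _ _ xC) (Ceq _ _ yC) e1 e2 e3 e4; apply: ext.
  (* [z1] serves when two variables on the left coincide, in [a] with [x5 = b]; [z2] when one of
     them equals [x5 = a] and another is [b]. *)
  pose z1 (a b : G) := b *+ 4 - a - a; pose z2 (a b : G) := a *+ 4 - a - b.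
  case: k => [[|[|[|[|[|[|[|[|[|[|//]]]]]]]]]] lt].
  - apply: (cls _ x1 x5 x3 x4 z1); [by move=> x /inX[]|move=> x /eqP /= e|
      move=> x y /eqP /= e /eqP /= e' *].
      by rewrite E34 /z1 -e.
    by split=> //; rewrite -e -e'.
  - apply: (cls _ x1 x5 x2 x4 z1); [by move=> x /inX[]|move=> x /eqP /= e|
      move=> x y /eqP /= e /eqP /= e' *].
      by rewrite E24 /z1 -e.
    by split=> //; rewrite -e -e'.
  - apply: (cls _ x2 x5 x1 x4 z1); [by move=> x /inX[]|move=> x /eqP /= e|
      move=> x y /eqP /= e /eqP /= e' *].
      by rewrite E14 /z1 -e.
    by split=> //; rewrite -e -e'.
  - apply: (cls _ x1 x5 x2 x3 z1); [by move=> x /inX[]|move=> x /eqP /= e|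
      move=> x y /eqP /= e /eqP /= e' *].
      by rewrite E23 /z1 -e.
    by split.
  - apply: (cls _ x2 x5 x1 x3 z1); [by move=> x /inX[]|move=> x /eqP /= e|
      move=> x y /eqP /= e /eqP /= e' *].
      by rewrite E13 /z1 -e.
    by split.
  - apply: (cls _ x3 x5 x1 x2 z1); [by move=> x /inX[]|move=> x /eqP /= e|
      move=> x y /eqP /= e /eqP /= e' *].
      by rewrite E12 /z1 -e.
    by split.
  - apply: (cls _ x1 x2 x3 x4 z2); [by move=> x /inX[]|move=> x /eqP /= e|
      move=> x y /eqP /= e /eqP /= e' *].
      by rewrite E34 /z2 -e.
    by split=> //; rewrite -e -e'.
  - apply: (cls _ x2 x1 x3 x4 z2); [by move=> x /inX[]|move=> x /eqP /= e|
      move=> x y /eqP /= e /eqP /= e' *].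
      by rewrite E34 /z2 -e addrAC.
    by split=> //; rewrite -e -e'.
  - apply: (cls _ x3 x1 x2 x4 z2); [by move=> x /inX[]|move=> x /eqP /= e|
      move=> x y /eqP /= e /eqP /= e' *].
      by rewrite E24 /z2 -e addrAC.
    by split=> //; rewrite -e -e'.
  - apply: (cls _ x4 x1 x2 x3 z2); [by move=> x /inX[]|move=> x /eqP /= e|
      move=> x y /eqP /= e /eqP /= e' *].
      by rewrite E23 /z2 -e addrAC.
    by split=> //; rewrite -e -e'.
rewrite -natrX -natrM ler_nat; apply: (leq_trans cover).
apply: (@leq_trans (\sum_(k < 10) 2 * #|A| ^ 2)); first by apply: leq_sum => k _.
by rewrite sum_nat_const card_ord mulnA.
Qed.

End Degenerate.

(** * Passing from integers to a cyclic group *)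

Section Embedding.
Variables (n : nat) (A : {set 'I_n.+1}).
Local Open Scope ring_scope.

(** Modulo [4 n + 1], a sum of four integers up to [n] does not wrap around, and 4 is invertible. *)
Definition emb (x : 'I_n.+1) : 'I_(4 * n).+1 := inord x.

Lemma val_emb x : nat_of_ord (emb x) = x.
Proof. by rewrite inordK // ltnS (leq_trans (leq_ord x)) // leq_pmull. Qed.

Lemma emb_inj : injective emb.
Proof. by move=> x y /(congr1 (@nat_of_ord _)); rewrite !val_emb => /ord_inj. Qed.

Lemma val_embD x y : nat_of_ord (emb x + emb y) = (x + y)%N.
Proof.
rewrite /= !val_emb modn_small // ltnS; have := leq_ord x; have := leq_ord y; lia.
Qed.

Lemma val_embD4 x y z w :
  nat_of_ord (emb x + emb y + emb z + emb w) = (x + y + z + w)%N.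
Proof.
have lx := leq_ord x; have ly := leq_ord y; have lz := leq_ord z; have lw := leq_ord w.
have -> : nat_of_ord (emb x + emb y + emb z + emb w) =
  ((((emb x + emb y)%R + emb z) %% (4 * n).+1 + emb w) %% (4 * n).+1)%N by [].
by rewrite val_embD !val_emb !modn_small //; lia.
Qed.

Lemma val_emb4 x : nat_of_ord (emb x *+ 4) = (4 * x)%N.
Proof.
rewrite Zp_mulrn /= val_emb modn_small ?(mulnC x) //.
by rewrite ltnS leq_mul2l leq_ord.
Qed.

(** Since [4 n] is -1 modulo the order, multiplying by [n] recovers [-x]. *)
Lemma mulr4_inj : injective (fun x : 'I_(4 * n).+1 => x *+ 4).
Proof.
move=> x y e; have h (z : 'I_(4 * n).+1) : z *+ 4 *+ n = - z.
  apply/eqP; rewrite -mulrnA -addr_eq0 -mulrSr Zp_mulrn.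
  by apply/eqP/ord_inj; rewrite /= modnMl.
by apply: oppr_inj; rewrite -!h e.
Qed.

Lemma sidon_emb : sidonb A -> sidon (emb @: A).
Proof.
move=> /forall_inP sA _ _ _ _ /imsetP[a aA ->] /imsetP[b bA ->] /imsetP[c cA ->]
  /imsetP[d dA ->] e ab.
have e' : (a + d)%N = (c + b)%N.
  by rewrite -!val_embD; congr nat_of_ord; rewrite -[emb a](subrK (emb b)) e addrAC subrK.
have /forall_inP/(_ d dA)/forall_inP/(_ c cA)/forall_inP/(_ b bA)/implyP := sA a aA.
rewrite e' eqxx => /(_ isT) /orP[/andP[/eqP -> /eqP ->] //|/andP[/eqP ea _]].
by rewrite ea eqxx in ab.
Qed.

Lemma no_distinct_emb x1 x2 x3 x4 x5 : no_4x5b A ->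
  x1 \in emb @: A -> x2 \in emb @: A -> x3 \in emb @: A -> x4 \in emb @: A ->
  x5 \in emb @: A -> x1 + x2 + x3 + x4 = x5 *+ 4 -> ~~ uniq [:: x1; x2; x3; x4; x5].
Proof.
move=> nA /imsetP[a aA ->] /imsetP[b bA ->] /imsetP[c cA ->] /imsetP[d dA ->].
move=> /imsetP[f fA ->] e.
apply/negP => u; move/negP: nA; apply.
have u' : uniq [:: a; b; c; d; f] by rewrite -(map_inj_uniq emb_inj).
apply/existsP; exists a; rewrite aA; apply/existsP; exists b; rewrite bA.
apply/existsP; exists c; rewrite cA; apply/existsP; exists d; rewrite dA.
apply/existsP; exists f; rewrite fA u' /=.
by rewrite -val_embD4 e val_emb4.
Qed.

End Embedding.

(** * The upper bound *)

Section UpperBound.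
Import ring lra.
Variable R : archiRealFieldType.
Local Open Scope ring_scope.

Lemma good_card_sqr_le (eps : R) : (0 < eps)%R ->
  exists N : nat, forall n : nat, (N <= n)%N -> forall A : {set 'I_n.+1}, good A ->
  (#|A|%:R ^+ 2 <= eps * n%:R)%R.
Proof.
(* Density [eps / 5] because [4 n + 1 <= 5 n]. Then [c |A|^3 <= 20 |A|^2] forces [|A| <= 20 / c],
   which fails for large [n]. *)
move=> e0; have d0 : 0 < eps / 5 by rewrite divr_gt0.
have [c c0 [N0 H]] := sidon_count d0.
have [n1 H1] := natr_bound (400 / (c ^+ 2 * eps)).
exists (maxn N0 (maxn n1 1)) => n; rewrite !geq_max => /and3P[l0 l1 l2] A /and3P[_ sA nA].
rewrite leNgt; apply/negP => big.
have sB := sidon_emb sA; set B := (@emb n) @: A in sB.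
have cB : #|B| = #|A| by rewrite card_imset //; exact: emb_inj.
have n0 : 1 <= n%:R :> R by rewrite ler1n.
have cG : #|'I_(4 * n).+1|%:R = 4 * n%:R + 1 :> R.
  by rewrite card_ord -natr1 natrM.
have dB : eps / 5 * #|'I_(4 * n).+1|%:R <= #|B|%:R ^+ 2.
  by rewrite cG cB; have := ler_wpM2l (ltW e0) n0; lra.
have lG : (N0 <= #|{: 'I_(4 * n).+1}|)%N.
  by rewrite card_ord; apply: (leq_trans l0); lia.
have low := H _ B lG (@mulr4_inj n) sB dB.
have up := cnt_degenerate_le R sB
  (fun x1 x2 x3 x4 x5 => @no_distinct_emb n A x1 x2 x3 x4 x5 nA).
have := le_trans low up; rewrite cB; set a := (#|A|%:R : R) in big * => ineq.
have a2 : 0 < a ^+ 2.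
  by apply: le_lt_trans big; rewrite mulr_ge0 ?ler0n ?ltW.
have ca : c * a <= 20.
  by rewrite -(ler_pM2r a2); apply: le_trans ineq; rewrite -mulrA -exprS.
have ca2 : (c * a) ^+ 2 <= 20 ^+ 2.
  by rewrite lerXn2r // nnegrE ?mulr_ge0 ?ler0n ?ltW.
have : 400 <= (c ^+ 2 * eps) * n%:R.
  by rewrite -ler_pdivrMl ?mulr_gt0 ?exprn_gt0 // mulrC H1.
have := ltr_pM2l (exprn_gt0 2 c0) (eps * n%:R) (a ^+ 2); rewrite big exprMn in ca2 *.
by move: ca2; clear; lra.
Qed.

End UpperBound.

(** * Lower bound: digits of elements of a finite field *)

Lemma field_with_digits (p k : nat) : prime p -> (0 < k)%N ->
  exists (F : finFieldType) (phi : F -> nat -> nat),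
  [/\ p \in [pchar F]%R, #|F| = (p ^ k)%N, forall u i, (phi u i < p)%N &
    forall u v w z, (forall i, (i < k)%N -> (phi u i + phi v i = phi w i + phi z i)%N) ->
    (u + v = w + z)%R].
Proof.
move=> pp k0; have [F chF cF] := pPrimePowerField pp k0.
pose L := pPrimeCharType chF.
have dimL : \dim {:L} = k.
  by rewrite pprimeChar_dimf; rewrite -[#|_|]/#|F| cF lognX logn_prime // eqxx muln1.
pose X := vbasis {:L}.
(* Digits are coordinates over the prime field, lifted to naturals below [p]; the default 0 fills
   positions from [k] on. *)
pose phi (u : F) (i : nat) : nat :=
  if insub i is Some j then nat_of_ord (coord X j (u : L)) else 0%N.
have Fp_p : (Zp_trunc (pdiv p)).+2 = p by exact: Fp_cast.
exists F, phi; split=> // [u i|u v w z e].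
  rewrite /phi; case: insubP => [j _ _|_]; last exact: prime_gt0.
  by rewrite -[X in (_ < X)%N]Fp_p ltn_ord.
have ext (x y : L) : (forall j, coord X j x = coord X j y) -> x = y.
  move=> h; rewrite (coord_vbasis (memvf x)) (coord_vbasis (memvf y)).
  by apply: eq_bigr => j _; rewrite h.
suff : ((u : L) + (v : L) = (w : L) + (z : L) :> L)%R by [].
apply: ext => j; rewrite !linearD /=; apply: val_inj => /=.
have := e j; rewrite -[X in (_ < X)%N]dimL ltn_ord => /(_ isT).
by rewrite /phi !valK => ->.
Qed.

(** * Positional encoding of digit vectors *)

Section Encoding.
Variable B : nat.
Local Open Scope nat_scope.

Definition enc (K : nat) (d : nat -> nat) : nat := \sum_(i < K) d i * B ^ i.

Lemma encS K d : enc K.+1 d = d 0 + B * enc K (fun i => d i.+1).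
Proof.
rewrite /enc big_ord_recl expn0 muln1 big_distrr; congr (_ + _).
by apply: eq_bigr => i _; rewrite /= expnS mulnCA.
Qed.

Lemma encD K d d' : enc K d + enc K d' = enc K (fun i => d i + d' i).
Proof. by rewrite -big_split; apply: eq_bigr => i _; rewrite /= mulnDl. Qed.

Lemma encM K c d : c * enc K d = enc K (fun i => c * d i).
Proof. by rewrite /enc big_distrr; apply: eq_bigr => i _; rewrite /= mulnA. Qed.

Lemma enc_lt K d : (forall i, i < K -> d i < B) -> enc K d < B ^ K.
Proof.
elim: K d => [|K IH] d lt; first by rewrite /enc big_ord0.
rewrite encS expnS; have := IH (fun i => d i.+1) (fun i h => lt i.+1 h).
have := lt 0 isT; set e := enc _ _; set q := B ^ K => h1 h2.
apply: (@leq_trans (B * e.+1)); first by rewrite mulnS ltn_add2r.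
by rewrite leq_mul2l h2 orbT.
Qed.

Lemma enc_inj K d d' : (forall i, i < K -> d i < B) -> (forall i, i < K -> d' i < B) ->
  enc K d = enc K d' -> forall i, i < K -> d i = d' i.
Proof.
elim: K d d' => [|K IH] d d' lt lt' // e.
have l0 := lt 0 isT; have l0' := lt' 0 isT.
rewrite !encS in e.
have e0 : d 0 = d' 0.
  have := congr1 (modn^~ B) e.
  by rewrite /= ![_ + B * _]addnC ![B * _]mulnC !modnMDl !modn_small.
case=> [|i] // lti.
apply: (IH (fun i => d i.+1) (fun i => d' i.+1)) => // [j|j|].
- exact: (lt j.+1).
- exact: (lt' j.+1).
move/eqP: e; rewrite e0 eqn_add2l eqn_mul2l => /orP[/eqP B0|/eqP //].
by rewrite B0 in l0.
Qed.

End Encoding.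

(** * Rigidity of the parabola and the sphere, and the construction *)

Section Determination.
Import ring lra.
Local Open Scope ring_scope.

(** The parabola is Sidon: [2 (a - c) (a - d)] is a combination of the two equations. *)
Lemma sum_prod_determine (F : fieldType) (a b c d : F) : (2 != 0 :> F)%R ->
  (a + b = c + d)%R -> (a ^+ 2 + b ^+ 2 = c ^+ 2 + d ^+ 2)%R ->
  (a = c /\ b = d) \/ (a = d /\ b = c).
Proof.
move=> n2 e1 e2.
have : 2 * ((a - c) * (a - d)) = 0.
  have -> : 2 * ((a - c) * (a - d)) =
    2 * a * (a + b - (c + d)) + ((c + d) ^+ 2 - (a + b) ^+ 2)
    + (a ^+ 2 + b ^+ 2 - (c ^+ 2 + d ^+ 2)) by ring.
  by rewrite e1 e2 !subrr mulr0 !addr0.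
move/eqP; rewrite !mulf_eq0 (negbTE n2) !subr_eq0 /= => /orP[]/eqP e; [left|right].
  by split=> //; apply: (addrI a); rewrite e1 e.
by split=> //; apply: (addrI a); rewrite e1 e addrC.
Qed.

(* The squared distances from [f5] to the other [fj] add up to [r + r + r + r - 4 r = 0]. *)
Lemma mean_on_sphere (k r : nat) (f1 f2 f3 f4 f5 : nat -> nat) :
  (forall i, (i < k)%N -> (f1 i + f2 i + f3 i + f4 i = 4 * f5 i)%N) ->
  (\sum_(i < k) f1 i ^ 2 = r)%N -> (\sum_(i < k) f2 i ^ 2 = r)%N ->
  (\sum_(i < k) f3 i ^ 2 = r)%N -> (\sum_(i < k) f4 i ^ 2 = r)%N ->
  (\sum_(i < k) f5 i ^ 2 = r)%N -> forall i, (i < k)%N -> f1 i = f5 i.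
Proof.
move=> e h1 h2 h3 h4 h5 i ik.
have Z f : (\sum_(i < k) f i ^ 2 = r)%N -> \sum_(i < k) ((f i)%:Z) ^+ 2 = r%:Z.
  move=> <-; rewrite -[RHS]natz natr_sum; apply: eq_bigr => j _.
  by rewrite natz PoszM.
pose T (i : 'I_k) : int := ((f1 i)%:Z - (f5 i)%:Z) ^+ 2 + ((f2 i)%:Z - (f5 i)%:Z) ^+ 2
  + ((f3 i)%:Z - (f5 i)%:Z) ^+ 2 + ((f4 i)%:Z - (f5 i)%:Z) ^+ 2.
have T0 : \sum_i T i = 0.
  have -> : \sum_i T i = \sum_(i < k) ((f1 i)%:Z ^+ 2 + (f2 i)%:Z ^+ 2 + (f3 i)%:Z ^+ 2
     + (f4 i)%:Z ^+ 2 - 4 * (f5 i)%:Z ^+ 2).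
    apply: eq_bigr => j _; rewrite /T.
    have ej : (f4 j)%:Z = 4 * (f5 j)%:Z - (f1 j)%:Z - (f2 j)%:Z - (f3 j)%:Z.
      by have := e j (ltn_ord j); lia.
    by rewrite ej; ring.
  rewrite sumrB !big_split -mulr_sumr /= !Z //; ring.
have Tge j : 0 <= T j by rewrite !addr_ge0 ?sqr_ge0.
have /eqP := T0; rewrite psumr_eq0 => [|j _]; last exact: Tge.
move/allP/(_ (Ordinal ik)); rewrite mem_index_enum => /(_ isT) /=.
rewrite /T /= !paddr_eq0 ?addr_ge0 ?sqr_ge0 // => /andP[/andP[/andP[]]].
by rewrite sqrf_eq0 subr_eq0 => /eqP[].
Qed.

End Determination.

(** Pigeonhole: the squared norm of a digit vector is below [k p^2], so that many spheres cover the
    field, and each one encodes to a good set. *)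
Lemma Smax_ge (p k n : nat) : prime p -> (2 < p)%N -> (0 < k)%N ->
  ((4 * p) ^ (2 * k) <= n)%N -> (p ^ k <= k * p ^ 2 * Smax n)%N.
Proof.
move=> pp p2 k0 len.
have [F [phi [chF cF lt_phi sum_phi]]] := field_with_digits pp k0.
have n2 : (2 != 0 :> F)%R.
  rewrite -(dvdn_pcharf chF); apply/negP => /dvdn_leq; lia.
have phi_inj u v : (forall i, (i < k)%N -> phi u i = phi v i) -> u = v.
  move=> h; have := sum_phi u 0%R v 0%R; rewrite !addr0; apply=> i ik.
  by rewrite h.
(* The point [(u, u^2)] of the parabola, as [2 k] digits. *)
pose D u i := if (i < k)%N then phi u i else phi (u ^+ 2)%R (i - k)%N.
have ltD u i : (D u i < p)%N by rewrite /D; case: ifP.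
(* The successor avoids 0; it adds the same amount to both sides of either equation. *)
pose code u := (enc (4 * p) (2 * k) (D u)).+1.
have code_le u : (code u <= n)%N.
  apply: leq_trans len; apply: enc_lt => i _; have := ltD u i; lia.
pose emb u : 'I_n.+1 := inord (code u).
have val_emb u : nat_of_ord (emb u) = code u by rewrite inordK // ltnS.
have code_inj u v : code u = code v -> u = v.
  case=> /(@enc_inj (4 * p)) h; apply: phi_inj => i ik.
  have lt w j : (j < 2 * k)%N -> (D w j < 4 * p)%N by have := ltD w j; lia.
  by have := h (lt u) (lt v) i; rewrite /D ik; apply; lia.
have emb_inj : injective emb.
  by move=> u v /(congr1 (@nat_of_ord _)); rewrite !val_emb; exact: code_inj.
pose X r : {set F} := [set u | \sum_(i < k) phi u i ^ 2 == r]%N.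
have goodX r : good (emb @: X r).
  apply/and3P; split.
  - apply/imsetP => -[u _ /(congr1 (@nat_of_ord _))]; by rewrite val_emb.
  - apply/forall_inP => _ /imsetP[a aX ->]; apply/forall_inP => _ /imsetP[b bX ->].
    apply/forall_inP => _ /imsetP[c cX ->]; apply/forall_inP => _ /imsetP[d dX ->].
    apply/implyP; rewrite !val_emb => /eqP e.
    have e' : (enc (4 * p) (2 * k) (D a) + enc (4 * p) (2 * k) (D b) =
      enc (4 * p) (2 * k) (D c) + enc (4 * p) (2 * k) (D d))%N by move: e; rewrite /code; lia.
    rewrite !encD in e'.
    have dg i : (i < 2 * k)%N -> (D a i + D b i = D c i + D d i)%N.
      apply: (enc_inj _ _ e') => j _.
        by have := ltD a j; have := ltD b j; lia.
      by have := ltD c j; have := ltD d j; lia.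
    have e1 : (a + b = c + d)%R.
      apply: sum_phi => i ik; have := dg i; rewrite /D ik; apply; lia.
    have e2 : (a ^+ 2 + b ^+ 2 = c ^+ 2 + d ^+ 2)%R.
      apply: sum_phi => i ik; have kki : (k + i < k)%N = false by rewrite ltnNge leq_addr.
      by have := dg (k + i)%N; rewrite /D kki addKn; apply; lia.
    by have [[-> ->]|[-> ->]] := sum_prod_determine n2 e1 e2; rewrite !eqxx ?orbT.
  - apply/negP => /exists_inP[_ /imsetP[a aX ->]] /exists_inP[_ /imsetP[b bX ->]].
    case/exists_inP=> _ /imsetP[c cX ->] /exists_inP[_ /imsetP[d dX ->]].
    case/exists_inP=> _ /imsetP[f fX ->] /andP[u]; rewrite !val_emb => /eqP e.
    have e' : (enc (4 * p) (2 * k) (D a) + enc (4 * p) (2 * k) (D b) +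
      enc (4 * p) (2 * k) (D c) + enc (4 * p) (2 * k) (D d) =
      4 * enc (4 * p) (2 * k) (D f))%N by move: e; rewrite /code; lia.
    rewrite !encD encM in e'.
    have dg i : (i < 2 * k)%N -> (D a i + D b i + D c i + D d i = 4 * D f i)%N.
      apply: (enc_inj _ _ e') => j _.
        by have := ltD a j; have := ltD b j; have := ltD c j; have := ltD d j; lia.
      by have := ltD f j; lia.
    have af : a = f.
      apply: phi_inj; move: aX bX cX dX fX; rewrite !inE.
      move=> /eqP ha /eqP hb /eqP hc /eqP hd /eqP hf.
      apply: (mean_on_sphere _ ha hb hc hd hf) => i ik.
      by have := dg i; rewrite /D ik; apply; lia.
    by move: u; rewrite af /= !inE eqxx !orbT.
have Xle r : (#|X r| <= Smax n)%N.
  rewrite -(card_imset _ emb_inj).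
  exact: (@leq_bigmax_cond _ (@good n) (fun A => #|A|) _ (goodX r)).
have cover : (#|F| <= \sum_(r < k * p ^ 2) #|X r|)%N.
  have -> : (\sum_(r < k * p ^ 2) #|X r| =
    \sum_(u : F) \sum_(r < k * p ^ 2) (\sum_(i < k) phi u i ^ 2 == r))%N.
    rewrite exchange_big /=; apply: eq_bigr => r _.
    by rewrite -sum1_card big_mkcond; apply: eq_bigr => u _; rewrite inE; case: eqP.
  rewrite -sum1_card; apply: leq_sum => u _.
  have lt : (\sum_(i < k) phi u i ^ 2 < k * p ^ 2)%N.
    apply: (@leq_ltn_trans (\sum_(i < k) (p ^ 2).-1)).
      by apply: leq_sum => i _; have := lt_phi u i; rewrite -(ltn_sqr); lia.
    rewrite sum_nat_const card_ord ltn_pmul2l // prednK //.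
    by rewrite expn_gt0 prime_gt0.
  by rewrite (bigD1 (Ordinal lt)) //= eqxx.
rewrite -cF; apply: (leq_trans cover); apply: (@leq_trans (\sum_(r < k * p ^ 2) Smax n)).
  by apply: leq_sum => r _.
by rewrite sum_nat_const card_ord.
Qed.

(** * Real asymptotics *)

Open Scope R_scope.

Lemma Smax_sqr_le (eps : R) : 0 < eps ->
  exists N : nat, forall n : nat, (N <= n)%nat -> INR (Smax n) ^ 2 <= eps * INR n.
Proof.
move=> /RltP e0; have [N H] := @good_card_sqr_le R eps e0.
exists N => n Nn.
have n0 := pos_INR n.
rewrite /Smax; apply: (@big_ind _ (fun m => INR m ^ 2 <= eps * INR n)) => [|a b|A].
- rewrite /=; move/RltP: e0 => e0; nra.
- by rewrite /maxn; case: ifP.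
- by move=> /(H n Nn A)/RleP; rewrite !INRE RpowE.
Qed.

Lemma pow4_ge (k p : nat) : (p ^ 3 <= k)%nat -> (k * p ^ 3 <= 4 ^ k)%nat.
Proof.
move=> pk; rewrite (_ : 4 = 2 * 2)%N // expnMn.
have k2 : (k <= 2 ^ k)%N by apply: ltnW; exact: ltn_expl.
by apply: leq_mul => //; exact: leq_trans k2.
Qed.

Lemma INR_expn (m k : nat) : INR (m ^ k)%N = INR m ^ k.
Proof. by elim: k => [|k IH] //; rewrite expnS mult_INR IH. Qed.

(** The prime [p] is fixed with [p^eps >= 4] and only [k] grows with [n]. The saving in the exponent
    yields a factor [Q^(k+1)], at least [4^(k+1)], which absorbs both the constant in the base [4 p]
    and the loss [k p^3]. *)
Lemma Smax_ge_Rpower (eps : R) : 0 < eps < 1 / 2 ->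
  exists N : nat, forall n : nat, (N <= n)%nat ->
    Rpower (INR n) (1 / 2 - eps) <= INR (Smax n).
Proof.
move=> [e0 e1].
have [M HM] := INR_unbounded (Rpower 4 (1 / eps)).
have [p pM pp] := prime_above (maxn M 2).
have {pM} [pM p2] : (M < p)%N /\ (2 < p)%N by move: pM; rewrite gtn_max => /andP.
have INR4 : INR 4 = 4 by rewrite /=; lra.
set P := INR p; have P4 : Rpower 4 (1 / eps) <= P.
  by have := le_INR M p; rewrite -/P => h; apply: Rle_trans (Rlt_le _ _ HM) (h _); lia.
have P0 : 0 < P by apply: Rlt_le_trans P4; exact: exp_pos.
set Q := Rpower P eps.
have Q4 : 4 <= Q.
  have -> : 4 = Rpower (Rpower 4 (1 / eps)) eps.
    by rewrite Rpower_mult (_ : 1 / eps * eps = 1) ?Rpower_1; [lra|lra|field; lra].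
  apply: Rle_Rpower_l; first lra.
  by split => //; exact: exp_pos.
set B := 4 * P.
have B1 : 1 < B.
  have : 2 < P by have := lt_INR 2 p; rewrite -/P /= => h; apply: h; lia.
  rewrite /B; lra.
pose b := ((4 * p) ^ 2)%N.
have b1 : (1 < b)%N by rewrite /b; nia.
have Bb : INR b = B ^ 2 by rewrite /b INR_expn mult_INR INR4.
(* This threshold forces [k > p^3], as [pow4_ge] requires. *)
exists (b ^ (p ^ 3).+1)%N => n Nn.
have n1 : (0 < n)%N by apply: leq_trans Nn; rewrite expn_gt0; lia.
pose k := trunc_log b n.
have kn : (b ^ k <= n)%N by apply: trunc_logP.
have nk : (n < b ^ k.+1)%N by apply: trunc_log_ltn.
have pk : (p ^ 3 < k)%N by apply: trunc_log_max.
have k0 : (0 < k)%N by apply: leq_trans pk.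
have low : (p ^ k <= k * p ^ 2 * Smax n)%N.
  by apply: Smax_ge => //; rewrite expnM.
pose t := Rpower B (1 - 2 * eps).
have t0 : 0 < t by exact: exp_pos.
(* One factor [Q] pays for the power of 4 in [t], and [P^(1 - 2 eps) Q^2 = P]. *)
have tPQ : t * Q <= P.
  rewrite /t /B -Rpower_mult_distr; [|lra|exact: P0].
  have l4 : Rpower 4 (1 - 2 * eps) <= Q.
    apply: Rle_trans Q4; rewrite -{2}(Rpower_1 4); last lra.
    by apply: Rle_Rpower; lra.
  have eP : Rpower P (1 - 2 * eps) * Q * Q = P.
    rewrite /Q -!Rpower_plus (_ : _ + eps = 1); last by ring.
    exact: Rpower_1.
  have r0 : 0 < Rpower P (1 - 2 * eps) by exact: exp_pos.
  have : 0 <= (Q - Rpower 4 (1 - 2 * eps)) * (Rpower P (1 - 2 * eps) * Q).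
    by apply: Rmult_le_pos; [lra|apply: Rmult_le_pos; lra].
  lra.
have up : Rpower (INR n) (1 / 2 - eps) <= t ^ k.+1.
  have -> : t ^ k.+1 = Rpower (INR (b ^ k.+1)%N) (1 / 2 - eps).
    rewrite INR_expn Bb -(Rpower_pow _ _ t0) /t -Rpower_pow; last by nra.
    rewrite -(Rpower_pow 2 B); last lra.
    by rewrite !Rpower_mult; congr Rpower; rewrite /=; field.
  apply: Rle_Rpower_l; first lra.
  split; first by apply: (lt_INR 0); lia.
  by apply: le_INR; lia.
have tK0 : 0 < t ^ k.+1 by exact: pow_lt.
have tK : t ^ k.+1 * Q ^ k.+1 <= P ^ k.+1.
  rewrite -Rpow_mult_distr; apply: pow_incr; split=> //.
  by apply: Rmult_le_pos; lra.
have kQ : INR k * P ^ 3 <= Q ^ k.+1.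
  have l3 : INR k * P ^ 3 <= 4 ^ k.
    have := le_INR _ _ (ssrnat.leP (pow4_ge (ltnW pk))).
    by rewrite mult_INR !INR_expn INR4.
  apply: Rle_trans l3 _; apply: (@Rle_trans _ (4 ^ k.+1)).
    by apply: Rle_pow; [lra|lia].
  by apply: pow_incr; lra.
have k0R : 0 < INR k by apply: (lt_INR 0); lia.
have low' : P ^ k <= INR k * P ^ 2 * INR (Smax n).
  by have := le_INR _ _ (ssrnat.leP low); rewrite 2!mult_INR !INR_expn.
apply: Rle_trans up _; apply: (@Rmult_le_reg_l (INR k * P ^ 3)).
  by apply: Rmult_lt_0_compat => //; exact: pow_lt.
have h1 := Rmult_le_compat_l _ _ _ (Rlt_le _ _ tK0) kQ.
have h2 := Rmult_le_compat_l _ _ _ (Rlt_le _ _ P0) low'.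
have e3 : P ^ k.+1 = P * P ^ k by [].
have e4 : P * (INR k * P ^ 2 * INR (Smax n)) = INR k * P ^ 3 * INR (Smax n) by ring.
lra.
Qed.

Theorem theorem1p14 :
  Un_cv (fun n : nat => INR (Smax n) / sqrt (INR n)) 0 /\
  (forall eps : R, 0 < eps ->
     exists N : nat, forall n : nat, (N <= n)%nat ->
       Rpower (INR n) (1 / 2 - eps) <= INR (Smax n)).
Proof.
split=> [eps eps0|eps eps0].
(* Halving [eps] turns the weak bound into the strict one in the definition of convergence. *)
- have [|N HN] := @Smax_sqr_le ((eps / 2) ^ 2).
    by apply: pow_lt; lra.
  exists N.+1 => n Nn; have {}HN := HN n; have Nn' : (N <= n)%N by lia.
  have n0 : 0 < INR n by apply: (lt_INR 0); lia.
  have s0 := sqrt_lt_R0 _ n0; have S0 := pos_INR (Smax n).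
  rewrite /R_dist Rminus_0_r Rabs_pos_eq; last by apply: Rle_mult_inv_pos.
  apply: (@Rle_lt_trans _ (eps / 2)); last lra.
  apply: (@Rmult_le_reg_r (sqrt (INR n))) => //.
  rewrite /Rdiv Rmult_assoc Rinv_l ?Rmult_1_r; last lra.
  apply: Rsqr_incr_0_var; last by apply: Rmult_le_pos; lra.
  rewrite Rsqr_mult Rsqr_sqrt ?Rsqr_pow2; last lra.
  exact: HN.
(* For [n >= 1] a larger [eps] only weakens the claim, so [eps] may be capped below [1 / 2]. *)
- have [|N HN] := @Smax_ge_Rpower (Rmin eps (1 / 4)).
    by split; [apply: Rmin_glb_lt; lra|have := Rmin_r eps (1 / 4); lra].
  exists N.+1 => n Nn; apply: Rle_trans (HN n _); last lia.
  apply: Rle_Rpower; last by have := Rmin_l eps (1 / 4); lra.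
  by apply: (le_INR 1); lia.
Qed.
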